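(* Let $(\sigma,V^{(1)},V^{(2)})$ be an isometric covariant representation of the product system $\mathbb E$ over $\mathbb N_0^2$ on a Hilbert space $\mathcal H$ such that $(\sigma,V^{(i)})$ is pure for some $i\in\{1,2\}$, and let $j\in\{1,2\}$, $j\ne i$. Let $\mathcal M\subseteq\mathcal F(E_i)\otimes\mathcal W_i$ be a nonzero closed subspace. Then $\mathcal M$ is invariant for $(\rho_i,S^{\mathcal W_i},M_{\Theta_{V^{(j)}}})$ if and only if there exist a Hilbert space $\mathcal K$, an isometric covariant representation $(\varrho_i,V^{(i)'},V^{(j)'})$ of $\mathbb E$ on $\mathcal K$ such that $(\varrho_i,V^{(i)'})$ is pure with generating wandering subspace $\mathcal W_i'$, and an inner operator $\Psi:\mathcal W_i'\to\mathcal F(E_i)\otimes\mathcal W_i$ for $(\varrho_i,V^{(i)'})$ and $(\rho_i,S^{\mathcal W_i})$, such that $$M_\Psi\widetilde V^{(j)'}=\widetilde M_{\Theta_{V^{(j)}}}(I_{E_j}\otimes M_\Psi)\qquad\text{and}\qquad\mathcal M=M_\Psi\mathcal K.$$ In particular, $M_\Psi$ is multi-analytic for $(\varrho_i,V^{(i)'},V^{(j)'})$ and $(\rho_i,S^{\mathcal W_i},M_{\Theta_{V^{(j)}}})$.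
   Context: All $*$-homomorphisms and representations are nondegenerate. A $C^*$-correspondence over a $C^*$-algebra $\mathcal A$ is a Hilbert $\mathcal A$-module $F$ with a left action of $\mathcal A$ given by a $*$-homomorphism into the adjointable operators on $F$. Tensor products are interior tensor products, $F^{\otimes 0}=\mathcal A$, and for a representation $\sigma$ of $\mathcal A$ on a Hilbert space $\mathcal H$, $F\otimes\mathcal H=F\otimes_\sigma\mathcal H$ has inner product $\langle\xi_1\otimes h_1,\xi_2\otimes h_2\rangle=\langle h_1,\sigma(\langle\xi_1,\xi_2\rangle)h_2\rangle$; $\mathcal A\otimes\mathcal H$ is identified with $\mathcal H$. A (completely bounded) covariant representation of $F$ on $\mathcal H$ is a pair $(\sigma,V)$ with $\sigma:\mathcal A\to B(\mathcal H)$ a representation and $V:F\to B(\mathcal H)$ linear, completely bounded, with $V(b\xi a)=\sigma(b)V(\xi)\sigma(a)$. Put $\widetilde V:F\otimes\mathcal H\to\mathcal H$, $\widetilde V(\xi\otimes h)=V(\xi)h$, $\widetilde V_n(\xi_1\otimes\cdots\otimes\xi_n\otimes h)=V(\xi_1)\cdots V(\xi_n)h$ on $F^{\otimes n}\otimes\mathcal H$ ($\widetilde V_0=I$), and $V_n(\eta)h=\widetilde V_n(\eta\otimes h)$. It is isometric if $V(\eta)^*V(\xi)=\sigma(\langle\eta,\xi\rangle)$ (equivalently $\widetilde V$ is an isometry), and pure if $\widetilde V_n\widetilde V_n^*\to0$ strongly. If $(\sigma,V)$ is pure isometric, its generating wandering subspace is $\mathcal H\ominus\widetilde V(F\otimes\mathcal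 H)=:\mathcal W$, and $\mathcal H=\bigoplus_n\widetilde V_n(F^{\otimes n}\otimes\mathcal W)$. The Fock space is $\mathcal F(F)=\bigoplus_{n\ge0}F^{\otimes n}$ with the natural left action $\phi_\infty$. For a representation $\pi$ of $\mathcal A$ on $\mathcal K$, the induced representation $(\rho,S)$ of $F$ on $\mathcal F(F)\otimes_\pi\mathcal K$ is $\rho(a)=\phi_\infty(a)\otimes I$, $S(\xi)(\eta\otimes k)=(\xi\otimes\eta)\otimes k$. For pure isometric $(\sigma,V)$ the Wold–von Neumann decomposition is the unitary $\Pi_V:\mathcal H\to\mathcal F(F)\otimes\mathcal W$, $\Pi_V\widetilde V_n(\eta_n\otimes w)=\eta_n\otimes w$. A product system $\mathbb E$ over $\mathbb N_0^2$ consists of $C^*$-correspondences $E_1,E_2$ over $\mathcal A$ and a unitary isomorphism $t_{2,1}:E_2\otimes E_1\to E_1\otimes E_2$; $t_{1,2}=t_{2,1}^{-1}$. A covariant representation of $\mathbb E$ on $\mathcal H$ is a triple $(\sigma,V^{(1)},V^{(2)})$ where each $(\sigma,V^{(k)})$ is a covariant representation of $E_k$ and $\widetilde V^{(1)}(I_{E_1}\otimes\widetilde V^{(2)})=\widetilde V^{(2)}(I_{E_2}\otimes\widetilde V^{(1)})(t_{1,2}\otimes I_{\mathcal H})$; it is isometric if both $(\sigma,V^{(k)})$ are. When a triple is written with indices $i,j$, the entry with index $i$ represents $E_i$ and the entry with index $j$ represents $E_j$. $\mathcal W_i=\mathcal H\ominus\widetilde V^{(i)}(E_i\otimes\mathcal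 H)$ is the generating wandering subspace of $(\sigma,V^{(i)})$; $(\rho_i,S^{\mathcal W_i})$ is the induced representation of $E_i$ on $\mathcal F(E_i)\otimes\mathcal W_i$ induced by $\sigma|_{\mathcal W_i}$; $M_{\Theta_{V^{(j)}}}:E_j\to B(\mathcal F(E_i)\otimes\mathcal W_i)$ is $M_{\Theta_{V^{(j)}}}(\xi_j)=\Pi_{V^{(i)}}V^{(j)}(\xi_j)\Pi_{V^{(i)}}^*$. Then $(\rho_i,S^{\mathcal W_i},M_{\Theta_{V^{(j)}}})$ is an isometric covariant representation of $\mathbb E$ ($S^{\mathcal W_i}$ representing $E_i$ and $M_{\Theta_{V^{(j)}}}$ representing $E_j$). A nonzero closed subspace is invariant for a covariant representation $(\sigma,V^{(1)},V^{(2)})$ if it is invariant under $\sigma(\mathcal A)$ and under every $V^{(k)}(\xi_k)$, $\xi_k\in E_k$, $k=1,2$. A bounded operator between the spaces of two covariant representations of $\mathbb E$ is multi-analytic if it intertwines the representations of $\mathcal A$ and the respective maps on $E_1$ and on $E_2$. Inner operators: let $(\varrho,T)$ on $\mathcal K$ and $(\rho,S)$ on $\mathcal G$ be pure isometric covariant representations of $E_i$, and let $\mathcal W'$ be the generating wandering subspace of $(\varrho,T)$. For an operator $\Psi:\mathcal W'\to\mathcal G$ with $\rho(a)\Psi h=\Psi\varrho(a)h$ ($a\in\mathcal A$, $h\in\mathcal W'$), $M_\Psi:\mathcal K\to\mathcal G$ is determined by $M_\Psi T_n(\eta_n)h=S_n(\eta_n)\Psi h$ for $\eta_n\in E_i^{\otimes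 n}$, $h\in\mathcal W'$, $n\ge0$. $\Psi$ is called inner if $M_\Psi$ is an isometry. *)

(* Defs.v *)
From HB Require Import structures.
From mathcomp Require Import all_boot all_order all_algebra.
From mathcomp Require Import complex.
From mathcomp Require Import all_classical all_reals all_analysis.

Set Implicit Arguments.
Unset Strict Implicit.
Unset Printing Implicit Defensive.

Import Order.TTheory GRing.Theory Num.Theory numFieldNormedType.Exports.

Local Open Scope classical_set_scope.
Local Open Scope ring_scope.

(* Spaces are complete normed modules over the complex numbers R[i]; norms    *)
(* take their (nonnegative real) values in R[i]. All inner products are       *)
(* linear in the second variable.                                             *)

Section Operators.
Context {R : realType}.
Implicit Types X Y : normedModType R[i].

Definition linspan X (S : set X) : set X :=
  [set x | exists (n : nat) (c : 'I_n -> R[i]) (s : 'I_n -> X),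
     (forall k, S (s k)) /\ x = \sum_k c k *: s k].

Definition total_set X (S : set X) : Prop := closure (linspan S) = setT.

Definition closed_subspace X (M : set X) : Prop :=
  [/\ closed M, M 0 &
      forall (c : R[i]) x y, M x -> M y -> M (c *: x + y)].

Definition bounded_op X Y (f : X -> Y) : Prop := linear f /\ continuous f.

(* The bounded operator with property P. It is only used for properties that *)
(* bounded operators satisfy at most once; the default 0 is a junk value.     *)
Definition the_op X Y (P : set (X -> Y)) : X -> Y :=
  xget (fun=> 0) [set f | bounded_op f /\ P f].

Definition isometry X Y (f : X -> Y) : Prop :=
  bounded_op f /\ forall x, `|f x| = `|x|.

Lemma bounded_op_the_op X Y (P : set (X -> Y)) : bounded_op (the_op P).
Proof.
rewrite /the_op; case: xgetP => [f _ []//|_].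
by split=> [c x y|x]; [rewrite scaler0 addr0|exact: cvg_cst].
Qed.

Lemma total_eq X Y (S : set X) (f g : X -> Y) : total_set S ->
  bounded_op f -> bounded_op g -> (forall x, S x -> f x = g x) -> f =1 g.
Proof.
move=> tS [lf cf] [lg cg] fg x.
pose D := [set y | f y = g y].
have D0 : D 0.
  have h0 h : linear h -> h 0 = 0 :> Y.
    by move=> lh; have := lh (-1) 0 0; rewrite scaler0 addr0 scaleN1r addNr.
  by rewrite /D/= !h0.
have Dl c y z : D y -> D z -> D (c *: y + z).
  by rewrite /D/= lf lg => -> ->.
have cD : closed D.
  have -> : D = (fun y => f y - g y) @^-1` [set 0].
    by apply/seteqP; split=> y /=; rewrite /D/=;
      [move=> ->; rewrite subrr|move=> /eqP; rewrite subr_eq0 => /eqP].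
  apply: preimage_closed; last first.
    exact/accessible_closed_set1/hausdorff_accessible/norm_hausdorff.
  by move=> y _; apply: cvgB; [exact: cf|exact: cg].
suff sD : linspan S `<=` D.
  have : closure (linspan S) x by rewrite tS.
  by move=> /(closure_subset sD); rewrite -(closure_id D).1.
move=> y [n [c [s [Ss ->]]]].
elim: n c s Ss => [|n IH] c s Ss; first by rewrite big_ord0.
rewrite big_ord_recl; apply: Dl; first exact: fg.
by apply: IH => k; apply: Ss.
Qed.

End Operators.

Section CStarAlgebras.
Variable R : realType.

(* Not assumed unital. *)
Record cstarAlgebra := CStarAlgebra {
  cs_car :> completeNormedModType R[i];
  cs_mul : cs_car -> cs_car -> cs_car;
  cs_star : cs_car -> cs_car;
  cs_mulA : associative cs_mul;
  cs_mulDl : left_distributive cs_mul +%R;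
  cs_mulDr : right_distributive cs_mul +%R;
  cs_mulZl : forall (c : R[i]) a b, cs_mul (c *: a) b = c *: cs_mul a b;
  cs_mulZr : forall (c : R[i]) a b, cs_mul a (c *: b) = c *: cs_mul a b;
  cs_starD : {morph cs_star : a b / a + b};
  cs_starZ : forall (c : R[i]) a, cs_star (c *: a) = c^* *: cs_star a;
  cs_starM : forall a b, cs_star (cs_mul a b) = cs_mul (cs_star b) (cs_star a);
  cs_starK : involutive cs_star;
  cs_normM : forall a b, `|cs_mul a b| <= `|a| * `|b|;
  cs_norm_star : forall a, `|cs_mul (cs_star a) a| = `|a| ^+ 2 }.

End CStarAlgebras.

Arguments cs_mul {R c} : rename.
Arguments cs_star {R c} : rename.
Notation "a *c b" := (cs_mul a b) (at level 40, left associativity).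
Notation "a ^#" := (cs_star a) (at level 2, format "a ^#").

Section Modules.
Context {R : realType}.
Variable A : cstarAlgebra R.

Record hilbertModule := HilbertModule {
  hm_car :> completeNormedModType R[i];
  hm_act : hm_car -> A -> hm_car;
  hm_ip : hm_car -> hm_car -> A;
  hm_actDl : forall x y a, hm_act (x + y) a = hm_act x a + hm_act y a;
  hm_actDr : forall x a b, hm_act x (a + b) = hm_act x a + hm_act x b;
  hm_actZl : forall (c : R[i]) x a, hm_act (c *: x) a = c *: hm_act x a;
  hm_actZr : forall (c : R[i]) x a, hm_act x (c *: a) = c *: hm_act x a;
  hm_actA : forall x a b, hm_act x (a *c b) = hm_act (hm_act x a) b;
  hm_ip_linear : forall x, linear (hm_ip x);
  hm_ip_act : forall x y a, hm_ip x (hm_act y a) = hm_ip x y *c a;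
  hm_ip_star : forall x y, (hm_ip x y)^# = hm_ip y x;
  hm_ip_pos : forall x, exists b : A, hm_ip x x = b^# *c b;
  hm_norm : forall x, `|x| ^+ 2 = `|hm_ip x x| }.

Record corr := Corr {
  co_mod :> hilbertModule;
  co_act : A -> co_mod -> co_mod;
  co_act_bounded : forall a, bounded_op (co_act a);
  co_act_linear : forall x, linear (co_act ^~ x);
  co_actM : forall a b x, co_act (a *c b) x = co_act a (co_act b x);
  co_act_adj : forall a x y,
    hm_ip (co_act a x) y = hm_ip x (co_act a^# y) }.

Definition nondegenerate_corr (E : corr) : Prop :=
  total_set [set z : E | exists a x, z = co_act a x].

Record hilbertSpace := HilbertSpace {
  hs_car :> completeNormedModType R[i];
  hs_ip : hs_car -> hs_car -> R[i];
  hs_ip_linear : forall x (c : R[i]) y z,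
    hs_ip x (c *: y + z) = c * hs_ip x y + hs_ip x z;
  hs_ip_conj : forall x y, (hs_ip x y)^* = hs_ip y x;
  hs_norm : forall x, `|x| ^+ 2 = hs_ip x x }.

(* A Hilbert space with a *-representation sigma of A. *)
Record hrep := HRep {
  hr_space :> hilbertSpace;
  hr_act : A -> hr_space -> hr_space;
  hr_act_bounded : forall a, bounded_op (hr_act a);
  hr_act_linear : forall h, linear (hr_act ^~ h);
  hr_actM : forall a b h, hr_act (a *c b) h = hr_act a (hr_act b h);
  hr_act_adj : forall a h k,
    hs_ip (hr_act a h) k = hs_ip h (hr_act a^# k) }.

Definition nondegenerate_rep (H : hrep) : Prop :=
  total_set [set z : H | exists a h, z = hr_act a h].

Definition adjop (X Y : hilbertSpace) (f : X -> Y) : Y -> X :=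
  the_op [set g : Y -> X | forall x y, hs_ip (f x) y = hs_ip x (g y)].

End Modules.

Arguments hm_act {R A h} : rename.
Arguments hm_ip {R A h} : rename.
Arguments co_act {R A c} : rename.
Arguments hs_ip {R h} : rename.
Arguments hr_act {R A h} : rename.

Section IdentityCorrespondence.
Context {R : realType}.
Variable A : cstarAlgebra R.

Lemma cs_mul_bounded (a : A) : bounded_op (cs_mul a).
Proof.
have la : linear (cs_mul a) by move=> c x y; rewrite cs_mulDr cs_mulZr.
split=> //.
pose f : {linear A -> A} := HB.pack (cs_mul a) (GRing.isLinear.Build _ _ _ _ _ la).
apply: (@bounded_linear_continuous _ _ _ f).
apply/linear_boundedP; near=> r => x /=.
apply: le_trans (cs_normM a x) _; apply: ler_wpM2r => //.
Unshelve. all: by end_near. Qed.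

Definition id_hilbertModule : hilbertModule A.
Proof.
refine (@HilbertModule R A A (fun x a => x *c a) (fun x y => x^# *c y)
  _ _ _ _ _ _ _ _ _ _).
- by move=> x y a; rewrite cs_mulDl.
- by move=> x a b; rewrite cs_mulDr.
- by move=> c x a; rewrite cs_mulZl.
- by move=> c x a; rewrite cs_mulZr.
- by move=> x a b; rewrite cs_mulA.
- by move=> x c y z; rewrite cs_mulDr cs_mulZr.
- by move=> x y a; rewrite cs_mulA.
- by move=> x y; rewrite cs_starM cs_starK.
- by move=> x; exists x.
- by move=> x; rewrite cs_norm_star.
Defined.

Definition id_corr : corr A.
Proof.
refine (@Corr R A id_hilbertModule (fun a x => a *c x) _ _ _ _).
- exact: cs_mul_bounded.
- by move=> x c a b; rewrite cs_mulDl cs_mulZl.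
- by move=> a b x; rewrite cs_mulA.
- by move=> a x y /=; rewrite cs_starM cs_mulA.
Defined.

End IdentityCorrespondence.

(* Closed subspaces of Hilbert spaces are Hilbert spaces. *)
Section Subspace.
Context {R : realType} {H : completeNormedModType R[i]}.
Variables (M : set H) (clM : closed_subspace M).

Definition subspace_pred of closed_subspace M : {pred H} := fun x => x \in M.

Lemma subspace_predP : submod_closed (subspace_pred clM).
Proof.
have [_ M0 Ml] := clM; split; first exact: mem_set.
by move=> c x y /set_mem Mx /set_mem My; apply/mem_set/Ml.
Qed.

HB.instance Definition _ := GRing.isSubmodClosed.Build R[i] H
  (subspace_pred clM) (GRing.submod_closed_semi subspace_predP).

Definition subsp := {x : H | x \in subspace_pred clM}.
HB.instance Definition _ := Choice.on subsp.
HB.instance Definition _ := SubType.on subsp.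
HB.instance Definition _ := [SubChoice_isSubLmodule of subsp by <:].

Definition subsp_norm (x : subsp) : R[i] := `|val x|.

Lemma ler_subsp_normD (x y : subsp) :
  subsp_norm (x + y) <= subsp_norm x + subsp_norm y.
Proof. by rewrite /subsp_norm raddfD; exact: ler_normD. Qed.

Lemma subsp_normZ (c : R[i]) (x : subsp) :
  subsp_norm (c *: x) = `|c| * subsp_norm x.
Proof. by rewrite /subsp_norm linearZ; exact: normrZ. Qed.

Lemma subsp_norm0 (x : subsp) : subsp_norm x = 0 -> x = 0.
Proof. by move=> /normr0_eq0 x0; apply: val_inj; rewrite x0 raddf0. Qed.

HB.instance Definition _ := Lmodule_isNormed.Build R[i] subsp
  ler_subsp_normD subsp_normZ subsp_norm0.

Lemma subsp_val_norm (x : subsp) : `|x| = `|val x|. Proof. by []. Qed.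

Lemma ball_subsp (x y : subsp) e : ball x e y = ball (val x) e (val y).
Proof. by rewrite -!ball_normE /ball_/= subsp_val_norm raddfB. Qed.

Lemma subsp_val_continuous : continuous (val : subsp -> H).
Proof.
apply: (@bounded_linear_continuous _ subsp H val).
apply/linear_boundedP; near=> r => x.
by rewrite -subsp_val_norm ler_peMl.
Unshelve. all: by end_near. Qed.

Lemma subsp_continuous (T : topologicalType) (f : T -> subsp) :
  continuous (val \o f) -> continuous f.
Proof.
move=> cf x; apply/cvg_ballP => e e0.
have /cvg_ballP/(_ e e0) := cf x.
by apply: filterS => y; rewrite ball_subsp.
Qed.

Lemma subsp_complete (F : set_system subsp) :
  ProperFilter F -> cauchy F -> cvg F.
Proof.
move=> FF /cauchy_ballP cF.
have cvF : cvg (val @ F).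
  apply: cauchy_cvg; apply/cauchy_ballP => e e0.
  have [[P Q] /= [FP FQ] PQ] := cF e e0.
  exists (val @` P, val @` Q) => /=.
    by split; [apply: filterS FP|apply: filterS FQ] => x Px; exists x.
  by move=> [_ _] /= [[x Px <-] [y Qy <-]]; rewrite -ball_subsp; apply: (PQ (x, y)).
have Ml : lim (val @ F) \in subspace_pred clM.
  have [cM _ _] := clM; apply/mem_set.
  apply: (@closed_cvg _ _ F FF val M cM _ _ cvF).
  by apply: nearW => x; exact: set_mem (valP x).
apply/cvg_ex; exists (@exist H (fun x => x \in subspace_pred clM) _ Ml : subsp); apply/cvg_ballP => e e0.
near=> x; rewrite ball_subsp /=.
by near: x; move: e e0; apply/cvg_ballP.
Unshelve. all: by end_near. Qed.

HB.instance Definition _ := Uniform_isComplete.Build subsp subsp_complete.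

Definition subsp_completeNormedModType : completeNormedModType R[i] := subsp.

End Subspace.

Section SubRepresentation.
Context {R : realType} {A : cstarAlgebra R} {H : hrep A}.
Variables (M : set H) (clM : closed_subspace M).
Variable (invM : forall a x, M x -> M (hr_act a x)).

Definition sub_hilbertSpace : hilbertSpace (R := R).
Proof.
refine (@HilbertSpace R (subsp_completeNormedModType clM)
  (fun x y => hs_ip (val x) (val y)) _ _ _).
- by move=> x c y z; rewrite linearP; exact: hs_ip_linear.
- by move=> x y; exact: hs_ip_conj.
- by move=> x; exact: hs_norm.
Defined.

Definition sub_act (a : A) (x : subsp clM) : subsp clM :=
  @exist H (fun x => x \in subspace_pred clM) (hr_act a (val x))
    (mem_set (invM a (set_mem (valP x)))).

Lemma sub_act_bounded (a : A) :
  @bounded_op R (subsp clM) (subsp clM) (sub_act a).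
Proof.
have [la ca] := hr_act_bounded H a.
split.
  move=> c x y; apply: val_inj; rewrite linearP -[LHS]/(hr_act a (val _)).
  by rewrite linearP la.
apply: subsp_continuous => x.
apply: (@continuous_comp _ _ _ (val : subsp clM -> H) (hr_act a)); last exact: ca.
exact: subsp_val_continuous.
Qed.

Definition sub_hrep : hrep A.
Proof.
refine (@HRep R A sub_hilbertSpace sub_act _ _ _ _).
- exact: sub_act_bounded.
- by move=> x c a b; apply: val_inj; rewrite linearP; exact: hr_act_linear.
- by move=> a b x; apply: val_inj; exact: hr_actM.
- by move=> a x y; exact: hr_act_adj.
Defined.

End SubRepresentation.

Section InnerProduct.
Context {R : realType} {H : hilbertSpace (R := R)}.
Implicit Types x y z : H.

Lemma hs_ipZl (c : R[i]) x y z :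
  hs_ip (c *: x + y) z = c^* * hs_ip x z + hs_ip y z.
Proof.
rewrite -hs_ip_conj hs_ip_linear rmorphD rmorphM /=.
by rewrite (hs_ip_conj z x) (hs_ip_conj z y).
Qed.

Lemma hs_ipr0 x : hs_ip x 0 = 0.
Proof.
have := hs_ip_linear x (-1) 0 0.
by rewrite scaler0 addr0 mulN1r addNr.
Qed.

Lemma hs_ip_CauchySchwarz x y : `|hs_ip x y| <= `|x| * `|y|.
Proof.
have [->|y0] := eqVneq y 0; first by rewrite hs_ipr0 !normr0 mulr0.
have yy : 0 < hs_ip y y by rewrite -hs_norm exprn_gt0// normr_gt0.
pose z := hs_ip y y *: x + (- hs_ip y x) *: y.
have yz : hs_ip y z = 0.
  rewrite /z -[_ *: y]addr0 !hs_ip_linear hs_ipr0 addr0.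
  by rewrite mulNr mulrC subrr.
have xz : hs_ip x z = hs_ip y y * hs_ip x x - `|hs_ip x y| ^+ 2.
  rewrite /z -[_ *: y]addr0 !hs_ip_linear hs_ipr0 addr0 mulNr normCK.
  by rewrite hs_ip_conj [hs_ip y x * _]mulrC.
have : 0 <= hs_ip z z by rewrite -hs_norm exprn_ge0.
rewrite {1}/z -[_ *: y]addr0 !hs_ipZl yz mulr0 add0r.
have -> : hs_ip (0 : H) z = 0 by rewrite -hs_ip_conj hs_ipr0 rmorph0.
rewrite addr0 (hs_ip_conj y y) pmulr_rge0// xz subr_ge0 -!hs_norm => le2.
rewrite -(@ler_pXn2r _ 2)// ?nnegrE ?mulr_ge0//.
by rewrite exprMn mulrC.
Qed.

Lemma hs_ip_bounded x : bounded_op (hs_ip x : H -> R[i]^o).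
Proof.
have lx : linear (hs_ip x : H -> R[i]^o) by exact: hs_ip_linear.
split=> //.
pose f : {linear H -> R[i]^o} :=
  HB.pack (hs_ip x : H -> R[i]^o) (GRing.isLinear.Build _ _ _ _ _ lx).
apply: (@bounded_linear_continuous _ _ _ f).
apply/linear_boundedP; near=> r => y /=.
by apply: le_trans (hs_ip_CauchySchwarz x y) _; apply: ler_wpM2r.
Unshelve. all: by end_near. Qed.

Lemma hs_ip_total (S : set H) x :
  total_set S -> (forall y, S y -> hs_ip x y = 0) -> x = 0.
Proof.
move=> tS xS; apply/normr0_eq0/eqP; rewrite -sqrf_eq0 hs_norm.
have b0 : bounded_op (fun _ : H => 0 : R[i]^o).
  by split=> [c y z|y]; [rewrite scaler0 addr0|exact: cvg_cst].
by apply/eqP; exact: (total_eq tS (hs_ip_bounded x) b0 xS x).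
Qed.

Lemma closed_orth x : closed [set y | hs_ip y x = 0].
Proof.
have -> : [set y | hs_ip y x = 0] = hs_ip x @^-1` [set (0 : R[i]^o)].
  apply/seteqP; split=> y /= yx; rewrite -hs_ip_conj.
    by rewrite yx rmorph0.
  by rewrite yx rmorph0.
apply: (@preimage_closed H R[i]^o).
  by move=> y _; exact: (hs_ip_bounded x).2.
exact/accessible_closed_set1/hausdorff_accessible/norm_hausdorff.
Qed.

End InnerProduct.

(* Interior tensor products and countable direct sums always exist, and they  *)
(* are determined up to a unique unitary by the fields of the next three      *)
(* records. A tensorCalculus fixes one realization of each, i.e. the meaning  *)
(* of the notations E (x) F, E (x) H and (+)_n E_n.                           *)
Section Tensors.
Context {R : realType} {A : cstarAlgebra R}.

Record corrTensor (E F : corr A) := CorrTensor {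
  ct_space :> corr A;
  ct_tens : E -> F -> ct_space;
  ct_linearl : forall y, linear (ct_tens ^~ y);
  ct_linearr : forall x, linear (ct_tens x);
  ct_balanced : forall x a y, ct_tens (hm_act x a) y = ct_tens x (co_act a y);
  ct_ip : forall x1 y1 x2 y2,
    hm_ip (ct_tens x1 y1) (ct_tens x2 y2) = hm_ip y1 (co_act (hm_ip x1 x2) y2);
  ct_actl : forall a x y, co_act a (ct_tens x y) = ct_tens (co_act a x) y;
  ct_actr : forall x y a, hm_act (ct_tens x y) a = ct_tens x (hm_act y a);
  ct_total : total_set [set z | exists x y, z = ct_tens x y] }.

Record repTensor (E : corr A) (H : hrep A) := RepTensor {
  rt_space :> hrep A;
  rt_tens : E -> H -> rt_space;
  rt_linearl : forall h, linear (rt_tens ^~ h);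
  rt_linearr : forall x, linear (rt_tens x);
  rt_balanced : forall x a h, rt_tens (hm_act x a) h = rt_tens x (hr_act a h);
  rt_ip : forall x1 h1 x2 h2,
    hs_ip (rt_tens x1 h1) (rt_tens x2 h2) = hs_ip h1 (hr_act (hm_ip x1 x2) h2);
  rt_act : forall a x h, hr_act a (rt_tens x h) = rt_tens (co_act a x) h;
  rt_total : total_set [set z | exists x h, z = rt_tens x h] }.

Record corrSum (E : nat -> corr A) := CorrSum {
  sm_space :> corr A;
  sm_inj : forall n, E n -> sm_space;
  sm_inj_linear : forall n, linear (@sm_inj n);
  sm_inj_ip : forall n x y, hm_ip (@sm_inj n x) (@sm_inj n y) = hm_ip x y;
  sm_inj_orth : forall m n x y, m != n ->
    hm_ip (@sm_inj m x) (@sm_inj n y) = 0;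
  sm_inj_actl : forall n a x, co_act a (@sm_inj n x) = @sm_inj n (co_act a x);
  sm_inj_actr : forall n x a, hm_act (@sm_inj n x) a = @sm_inj n (hm_act x a);
  sm_total : total_set [set z | exists n x, z = @sm_inj n x] }.

Record tensorCalculus := TensorCalculus {
  tc_tensor : forall E F : corr A, corrTensor E F;
  tc_rep : forall (E : corr A) (H : hrep A), repTensor E H;
  tc_sum : forall E : nat -> corr A, corrSum E }.

End Tensors.

Arguments tensorCalculus {R} A.
Arguments ct_tens {R A E F} c : rename.
Arguments rt_tens {R A E H} r : rename.
Arguments sm_inj {R A E} c n : rename.

Section Representations.
Context {R : realType} {A : cstarAlgebra R}.
Variable T : tensorCalculus A.
Implicit Types (E F : corr A) (H K G : hrep A).

Local Notation "E '\tc' F" := (tc_tensor T E F) (at level 40).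
Local Notation "E '\th' H" := (tc_rep T E H) (at level 40).

Definition tens {E F} : E -> F -> E \tc F := ct_tens (tc_tensor T E F).
Definition htens {E H} : E -> H -> E \th H := rt_tens (tc_rep T E H).

Definition tens_lift E H K (f : E -> H -> K) : E \th H -> K :=
  the_op [set L : E \th H -> K | forall x h, L (htens x h) = f x h].

(* \widetilde V *)
Definition tilde E H (V : E -> H -> H) : E \th H -> H := tens_lift V.

(* I_E (x) f, for f intertwining the representations of A *)
Definition id_tens E H K (f : H -> K) : E \th H -> E \th K :=
  tens_lift (fun (x : E) h => htens x (f h)).

(* t (x) I_H, for t a map of correspondences *)
Definition tens_id E F H (t : E -> F) : E \th H -> F \th H :=
  tens_lift (fun (x : E) (h : H) => htens (t x) h).

(* the canonical unitary from (E (x) F) (x) H to E (x) (F (x) H) *)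
Definition assoc E F H : (E \tc F) \th H -> E \th (F \th H) :=
  the_op [set L : (E \tc F) \th H -> E \th (F \th H) |
    forall x y h, L (htens (tens x y) h) = htens x (htens y h)].

Fixpoint tpow E (n : nat) : corr A :=
  match n with
  | 0 => id_corr A
  | m.+1 => match m with 0 => E | _ => E \tc tpow E m end
  end.

(* x (x) eta, with E (x) A identified with E when n = 0 *)
Definition creation E (n : nat) : E -> tpow E n -> tpow E n.+1 :=
  match n return E -> tpow E n -> tpow E n.+1 with
  | 0 => fun x a => hm_act x a
  | m.+1 => fun x eta => tens x eta
  end.

(* \widetilde V_n; the case n = 0 is the identification of A (x) H with H *)
Fixpoint tilde_n E H (V : E -> H -> H) (n : nat) : tpow E n \th H -> H :=
  match n return tpow E n \th H -> H with
  | 0 => tens_lift (fun (a : id_corr A) (h : H) => hr_act (a : A) h)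
  | m.+1 => the_op [set L : tpow E m.+1 \th H -> H |
      forall x eta h,
        L (htens (creation x eta) h) = V x (tilde_n V (htens eta h))]
  end.

Definition V_n E H (V : E -> H -> H) (n : nat) (eta : tpow E n) (h : H) : H :=
  tilde_n V (htens eta h).

(* norms of matrices over E, seen as operators from A^n to E^n *)
Definition mxnorm_le E (n : nat) (X : 'I_n -> 'I_n -> E) (r : R[i]) : Prop :=
  forall b : 'I_n -> A,
    `|\sum_k hm_ip (\sum_l hm_act (X k l) (b l)) (\sum_l hm_act (X k l) (b l))|
    <= r ^+ 2 * `|\sum_l (b l)^# *c b l|.

Definition completely_bounded E H (V : E -> H -> H) : Prop :=
  exists2 c : R[i], 0 <= c &
    forall (n : nat) (X : 'I_n -> 'I_n -> E) (r : R[i]), 0 <= r ->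
      mxnorm_le X r ->
      forall h : 'I_n -> H,
        \sum_k `|\sum_l V (X k l) (h l)| ^+ 2
        <= (c * r) ^+ 2 * \sum_l `|h l| ^+ 2.

Record covRep E H := CovRep {
  cr_map :> E -> H -> H;
  cr_nondegenerate : nondegenerate_rep H;
  cr_bounded : forall x, bounded_op (cr_map x);
  cr_linear : forall h, linear (cr_map ^~ h);
  cr_cb : completely_bounded cr_map;
  cr_covariant : forall b x a h,
    cr_map (co_act b (hm_act x a)) h = hr_act b (cr_map x (hr_act a h)) }.

Definition isometric E H (V : E -> H -> H) : Prop :=
  forall x y h, adjop (V x) (V y h) = hr_act (hm_ip x y) h.

Definition pure E H (V : E -> H -> H) : Prop :=
  forall h, tilde_n V (adjop (@tilde_n E H V n) h) @[n --> \oo] --> (0 : H).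

(* H (-) \widetilde V (E (x) H) *)
Definition wandering_set E H (V : E -> H -> H) : set H :=
  [set h | forall z, hs_ip h (tilde V z) = 0].

Lemma hm_act_co_act E b (x : E) a :
  co_act b (hm_act x a) = hm_act (co_act b x) a.
Proof.
apply/eqP; rewrite -subr_eq0; apply/eqP; set z := _ - _.
suff zz : hm_ip z z = 0.
  by apply/normr0_eq0/eqP; rewrite -sqrf_eq0 hm_norm zz normr0.
rewrite {2}/z addrC -scaleN1r hm_ip_linear hm_ip_act -(cs_starK b).
by rewrite -!co_act_adj hm_ip_act scaleN1r addNr.
Qed.

Lemma cr_actl E H (V : covRep E H) b x h :
  V (co_act b x) h = hr_act b (V x h).
Proof.
have ndH := cr_nondegenerate V.
have bV := cr_bounded V; have bA := hr_act_bounded H.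
have bc : bounded_op (hr_act b \o V x).
  have [lb cb] := bA b; have [lx cx] := bV x.
  split=> [c k l|k] /=; first by rewrite lx lb.
  by apply: continuous_comp; [exact: cx|exact: cb].
apply: (total_eq ndH (bV _) bc) => _ [a [k ->]] /=.
apply/eqP; rewrite -subr_eq0; apply/eqP.
apply: (hs_ip_total ndH) => _ [c [l ->]].
have [lc _] := bA c^#.
have -> : hs_ip (V (co_act b x) (hr_act a k) - hr_act b (V x (hr_act a k)))
    (hr_act c l) = hs_ip (hr_act c^# (V (co_act b x) (hr_act a k) -
    hr_act b (V x (hr_act a k)))) l by rewrite hr_act_adj cs_starK.
rewrite addrC -scaleN1r lc -hr_actM -!cr_covariant.
by rewrite co_actM hm_act_co_act scaleN1r addNr -hs_ip_conj hs_ipr0 rmorph0.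
Qed.

Lemma tilde_act E H (V : covRep E H) a z :
  hr_act a (tilde V z) = tilde V (hr_act a z).
Proof.
have [la ca] := hr_act_bounded H a.
have ha0 : hr_act a 0 = 0 :> H.
  by have := la (-1) 0 0; rewrite scaler0 addr0 scaleN1r addNr.
rewrite /tilde /tens_lift /the_op.
case: xgetP => [L _ [[lL cL] LV]|_]; last by rewrite ha0.
have [lr cr] := hr_act_bounded (E \th H) a.
have b1 : bounded_op (hr_act a \o L).
  split=> [c x y|x] /=; first by rewrite lL la.
  by apply: continuous_comp; [exact: cL|exact: ca].
have b2 : bounded_op (L \o hr_act a).
  split=> [c x y|x] /=; first by rewrite lr lL.
  by apply: continuous_comp; [exact: cr|exact: cL].
apply: (total_eq (rt_total (tc_rep T E H)) b1 b2) => _ [x [h ->]] /=.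
by rewrite rt_act !LV cr_actl.
Qed.

Lemma wandering_closed E H (V : E -> H -> H) :
  closed_subspace (wandering_set V).
Proof.
split=> [|z|c x y Wx Wy z].
- have -> : wandering_set V = \bigcap_z [set h | hs_ip h (tilde V z) = 0].
    by apply/seteqP; split=> h Wh => [z _|z]; exact: Wh.
  by apply: closed_bigI => z _; exact: closed_orth.
- by rewrite -hs_ip_conj hs_ipr0 rmorph0.
- by rewrite hs_ipZl Wx Wy mulr0 addr0.
Qed.

Lemma wandering_inv E H (V : covRep E H) a h :
  wandering_set V h -> wandering_set V (hr_act a h).
Proof. by move=> Wh z; rewrite hr_act_adj tilde_act. Qed.

(* The generating wandering subspace, with the restriction of sigma. *)
Definition wandering E H (V : covRep E H) : hrep A :=
  sub_hrep (wandering_closed V) (@wandering_inv E H V).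

Definition wval E H (V : covRep E H) : wandering V -> H := val.

Definition fock E : corr A := tc_sum T (tpow E).

Definition fock_inj E (n : nat) : tpow E n -> fock E := sm_inj (tc_sum T _) n.

(* The maps S of the representation induced by K; rho is the action of A on   *)
(* the space fock E \th K.                                                   *)
Definition induced_map E K (x : E) : fock E \th K -> fock E \th K :=
  the_op [set L : fock E \th K -> fock E \th K | forall n (eta : tpow E n) k,
    L (htens (fock_inj eta) k) = htens (fock_inj (creation x eta)) k].

Definition wold E H (V : covRep E H) : H -> fock E \th wandering V :=
  the_op [set L : H -> fock E \th wandering V |
    forall n (eta : tpow E n) (w : wandering V),
      L (V_n V eta (wval w)) = htens (fock_inj eta) w].

(* M_Theta for a map W on a second correspondence F *)
Definition M_Theta E F H (V : covRep E H) (W : F -> H -> H) (x : F) :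
    fock E \th wandering V -> fock E \th wandering V :=
  wold V \o W x \o adjop (wold V).

Definition M_op E K G (V : covRep E K) (S : E -> G -> G)
    (Psi : wandering V -> G) : K -> G :=
  the_op [set L : K -> G | forall n (eta : tpow E n) (h : wandering V),
    L (V_n V eta (wval h)) = V_n S eta (Psi h)].

Definition inner E K G (V : covRep E K) (S : E -> G -> G)
    (Psi : wandering V -> G) : Prop :=
  [/\ bounded_op Psi,
      forall a h, hr_act a (Psi h) = Psi (hr_act a h) &
      isometry (M_op S Psi)].

Definition invariant_subspace E F G (V : E -> G -> G) (W : F -> G -> G)
    (M : set G) : Prop :=
  [/\ closed_subspace M, M <> [set 0],
      forall a g, M g -> M (hr_act a g),
      forall x g, M g -> M (V x g) &
      forall y g, M g -> M (W y g)].

Definition multi_analytic E F K G (V : E -> K -> K) (W : F -> K -> K)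
    (V' : E -> G -> G) (W' : F -> G -> G) (L : K -> G) : Prop :=
  [/\ bounded_op L,
      forall a k, L (hr_act a k) = hr_act a (L k),
      forall x k, L (V x k) = V' x (L k) &
      forall y k, L (W y k) = W' y (L k)].

(* The indices 1 and 2 are ord0 and ord_max. *)
Record productSystem := ProductSystem {
  ps_corr :> 'I_2 -> corr A;
  ps_nondegenerate : forall k, nondegenerate_corr (ps_corr k);
  ps_t21 : ps_corr ord_max \tc ps_corr ord0 -> ps_corr ord0 \tc ps_corr ord_max;
  ps_t12 : ps_corr ord0 \tc ps_corr ord_max -> ps_corr ord_max \tc ps_corr ord0;
  ps_t21K : cancel ps_t21 ps_t12;
  ps_t12K : cancel ps_t12 ps_t21;
  ps_t21_linear : linear ps_t21;
  ps_t21_ip : forall z w, hm_ip (ps_t21 z) (ps_t21 w) = hm_ip z w;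
  ps_t21_actl : forall a z, ps_t21 (co_act a z) = co_act a (ps_t21 z);
  ps_t21_actr : forall z a, ps_t21 (hm_act z a) = hm_act (ps_t21 z) a }.

Record psRep (P : productSystem) (H : hrep A) := PsRep {
  pr_rep :> forall k, covRep (P k) H;
  pr_comm : forall z : (P ord0 \tc P ord_max) \th H,
    tilde (pr_rep ord0) (id_tens (tilde (pr_rep ord_max)) (assoc z)) =
    tilde (pr_rep ord_max)
      (id_tens (tilde (pr_rep ord0)) (assoc (tens_id (@ps_t12 P) z))) }.

End Representations.

Arguments tilde {R A} T {E H} V _.
Arguments id_tens {R A} T E {H K} f _.
Arguments induced_map {R A} T E K x _.
Arguments M_Theta {R A} T {E F H} V W x _.
Arguments M_op {R A} T {E K G V} S Psi _.
Arguments inner {R A} T {E K G V} S Psi.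

(* Main.v *)
Require Import Defs.
From HB Require Import structures.
From mathcomp Require Import all_boot all_order all_algebra.
From mathcomp Require Import complex.
From mathcomp Require Import all_classical all_reals all_analysis.
From mathcomp Require Import ring lra.
Import Order.TTheory GRing.Theory Num.Theory numFieldNormedType.Exports.
Local Open Scope classical_set_scope.
Local Open Scope ring_scope.

(* By the Wold decomposition the unitary U = Pi carries (V^(i), V^(j)) to     *)
(* (S, M_Theta), so an invariant subspace M yields the isometric              *)
(* J = U^* o incl : M -> H whose range is invariant for the V^(k); pulling    *)
(* the V^(k) back along J gives the representation V' on K = M. Purity        *)
(* passes to V' since |P'_n m| <= |P_n J m| for the range projections P'_n,   *)
(* P_n of the n-th iterates, complete boundedness and the commutation         *)
(* relation since J is an isometric intertwiner. Taking for Psi the inclusion *)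
(* of the wandering subspace of V', M_Psi is the inclusion of M.              *)
(* Conversely, M_Psi intertwines everything on the total set of the vectors   *)
(* V'_n(eta) w, so its range is invariant.                                    *)

Set Implicit Arguments.
Unset Strict Implicit.
Unset Printing Implicit Defensive.

(* MathComp has a different notion named isometry. *)
Local Notation isometry := Defs.isometry.

(** * Norms and inner products *)

(** Let [U] be the Wold unitary of the pure representation with index [i]. By definition [M_Theta]
    is the conjugate of V^(j) by [U], and [induced_mapE] shows that the creation operators are the
    conjugate of V^(i) itself. So an invariant [M] is, up to [U], a joint invariant subspace of the
    original representation. Restricting to it gives an isometric representation ([psRep_restrict])
    that is still pure ([pure_restrict]). A pure isometric representation is generated by its
    wandering subspace ([wandering_total]), so the inclusion of [M] is determined by its values
    there and is therefore some M_Psi ([M_op_intertwiner]). For the converse, generation turns the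
    formula defining M_Psi into intertwining over A and E_i, the assumed identity adds E_j
    ([M_op_multi_analytic]), and the range of an intertwiner is invariant.

    The remaining work is existence. [adjop], [tens_lift], [assoc], [tilde_n], [wold] and [M_op] are
    selected by [the_op], which falls back to 0, so an operator with the required property has to be
    exhibited first. Adjoints come from [projection] and [riesz]. The tensor operators and [wold]
    come from [isometry_extension], because they preserve the Gram matrices of total families. A
    selected operator is then identified with the constructed one by agreement on a total set. *)

Section RealNorm.
Context {R : realType}.
Implicit Types (X Y : normedModType R[i]) (c : R[i]).
Local Notation "x %:C" := (real_complex R x) : ring_scope.

(** Norms live in [R[i]]; passing to the real part makes estimates accessible to [lra] and [nra]. *)
Definition nm {X} (x : X) : R := complex.Re `|x|.

Lemma nmE {X} (x : X) : `|x| = (nm x)%:C.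
Proof. by rewrite /nm RRe_real// ger0_real. Qed.

Lemma nm_ge0 {X} (x : X) : 0 <= nm x.
Proof. by rewrite -ler0c -nmE. Qed.

Lemma nm0 {X} : nm (0 : X) = 0.
Proof. by rewrite /nm normr0. Qed.

Lemma nm_eq0 {X} (x : X) : nm x = 0 -> x = 0.
Proof. by move=> x0; apply/normr0_eq0; rewrite nmE x0. Qed.

Lemma nmN {X} (x : X) : nm (- x) = nm x.
Proof. by rewrite /nm normrN. Qed.

Lemma nmC {X} (x y : X) : nm (x - y) = nm (y - x).
Proof. by rewrite -nmN opprB. Qed.

Lemma nmD {X} (x y : X) : nm (x + y) <= nm x + nm y.
Proof. by rewrite -lecR rmorphD /= -!nmE ler_normD. Qed.

Lemma nm_dist {X} (y x z : X) : nm (x - z) <= nm (x - y) + nm (y - z).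
Proof. by apply: le_trans (nmD _ _); rewrite addrA subrK. Qed.

Lemma nmZ {X} c (x : X) : nm (c *: x) = complex.Re `|c| * nm x.
Proof.
apply: complexI; rewrite -nmE normrZ (nmE x) rmorphM /= RRe_real// ger0_real.
Qed.

Lemma nmZr {X} (r : R) (x : X) : 0 <= r -> nm (r%:C *: x) = r * nm x.
Proof. by move=> r0; rewrite nmZ ger0_norm// ler0c. Qed.

Lemma posC (e : R[i]) : 0 < e -> exists2 r : R, 0 < r & e = r%:C.
Proof.
move=> e0; exists (complex.Re e); first by rewrite -ltcR RRe_real// gtr0_real.
by rewrite RRe_real// gtr0_real.
Qed.

Lemma cvg_nmP {X} {T} (F : set_system T) {FF : Filter F} (f : T -> X) (x : X) :
  f @ F --> x <-> forall e : R, 0 < e -> \forall t \near F, nm (x - f t) < e.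
Proof.
split=> [/cvgrPdist_lt fx e e0|fx].
  have /fx : 0 < e%:C by rewrite ltcR.
  by apply: filterS => t; rewrite nmE ltcR.
apply/cvgrPdist_lt => _ /posC [e e0 ->].
by apply: filterS (fx e e0) => t; rewrite nmE ltcR.
Qed.

Lemma continuous_nmP {X Y} (f : X -> Y) : linear f ->
  continuous f <-> exists C : R, forall x, nm (f x) <= C * nm x.
Proof.
move=> lf; pose g : {linear X -> Y} := HB.pack f (GRing.isLinear.Build _ _ _ _ _ lf).
split=> [cf|[C fC]].
  have /linear_boundedP := @continuous_linear_bounded _ _ _ 0 g (cf 0).
  rewrite /= => -[r [rr rP]]; exists (complex.Re r + 1) => x.
  have := rP (complex.Re r + 1)%:C; rewrite -{1}(RRe_real rr) ltcR ltrDl ltr01.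
  by move=> /(_ isT x); rewrite !nmE -rmorphM lecR.
apply: (@bounded_linear_continuous _ _ _ g).
apply/linear_boundedP; near=> r => x /=.
have rC : C%:C <= r by near: r; apply: nbhs_pinfty_ge; rewrite complex_real.
apply: le_trans (ler_wpM2r _ rC) => //.
by rewrite (nmE x) -rmorphM /= nmE lecR.
Unshelve. all: end_near. Qed.

Lemma closure_nmP {X} (S : set X) x :
  closure S x <-> forall e : R, 0 < e -> exists2 y, S y & nm (x - y) < e.
Proof.
split=> [Sx e e0|Sx B].
  have /Sx [y [Sy]] : nbhs x (ball x (e%:C : R[i])) by apply: nbhsx_ballx; rewrite ltcR.
  by rewrite -ball_normE /ball_/= nmE ltcR; exists y.
rewrite -filter_from_ballE => -[_ /posC [e e0 ->] eB].
have [y Sy xy] := Sx e e0; exists y; split=> //; apply: eB.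
by rewrite /= -ball_normE /ball_/= nmE ltcR.
Qed.

(** Completeness without choosing sequences: the images of the shrinking index sets [D e] generate a
    Cauchy filter. It yields the fixed point, the nearest point and the extended isometry below. *)
Lemma complete_family (X : completeNormedModType R[i]) (I : Type)
    (D : R -> set I) (v : I -> X) :
  (forall e, 0 < e -> D e !=set0) ->
  (forall d e, d <= e -> D d `<=` D e) ->
  (forall e, 0 < e -> exists2 d, 0 < d &
     forall a b, D d a -> D d b -> nm (v a - v b) < e) ->
  exists x, forall e, 0 < e -> exists2 d, 0 < d &
     forall a, D d a -> nm (x - v a) < e.
Proof.
move=> D0 Dm Dc.
pose F := filter_from [set e : R | 0 < e] (fun e => v @` D e).
have FF : ProperFilter F.
  apply: filter_from_proper; last first.
    by move=> e /= /D0 [a Da]; exists (v a), a.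
  apply: filter_from_filter; first by exists 1 => /=.
  move=> d e /= d0 e0; exists (Num.min d e); first by rewrite /= lt_min d0.
  by move=> _ [a Da <-]; split; exists a => //; apply: Dm Da;
    rewrite ge_min lexx ?orbT.
have cF : cauchy F.
  apply/cauchy_ballP => _ /posC [e e0 ->].
  have [d d0 Hd] := Dc e e0.
  exists (v @` D d, v @` D d) => /=; first by split; exists d.
  move=> [_ _] /= [[a Da <-] [b Db <-]].
  by rewrite -ball_normE /ball_/= nmE ltcR; exact: Hd.
have /cvg_ex [x Fx] : cvg F by exact: cauchy_cvg.
exists x => e e0.
have Fx' := (@cvg_nmP X X F (@filter_filter _ F FF) id x).1 Fx.
have [d d0 dP] := Fx' e e0.
by exists d => // a Da; apply: (dP (v a)); exists a.
Qed.

End RealNorm.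

(** * Square roots in a C*-algebra by a contraction argument *)

Section CStarContinuity.
Context {R : realType} {A : cstarAlgebra R}.
Implicit Types a b x y : A.
Local Notation "x %:C" := (real_complex R x) : ring_scope.

Lemma nm_mul a b : nm (a *c b) <= nm a * nm b.
Proof. by rewrite -lecR rmorphM /= -!nmE cs_normM. Qed.

Lemma nm_star_mul a : nm (a^# *c a) = nm a ^+ 2.
Proof. by apply: complexI; rewrite -nmE cs_norm_star nmE rmorphXn. Qed.

Lemma cs_mulNl a b : (- a) *c b = - (a *c b).
Proof. by rewrite -scaleN1r cs_mulZl scaleN1r. Qed.

Lemma cs_mulNr a b : a *c (- b) = - (a *c b).
Proof. by rewrite -scaleN1r cs_mulZr scaleN1r. Qed.

Lemma nm_star a : nm a^# = nm a.
Proof.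
suff le b : nm b <= nm b^# by apply/eqP; rewrite eq_le le -{2}(cs_starK a) le.
have [->|b0] := eqVneq b 0; first by rewrite nm0 nm_ge0.
have : 0 < nm b by rewrite lt_neqAle nm_ge0 andbT; apply: contra_neq b0 => /esym/nm_eq0.
by move=> /ler_pM2r <-; rewrite -expr2 -nm_star_mul nm_mul.
Qed.

(* [y] plays the role of [1 - sqrt (1 - x)]. *)
Lemma sqrt_fixpoint x : nm x <= 3 / 4 -> x^# = x ->
  exists2 y, y^# = y & x = y + y - y *c y.
Proof.
move=> xs sx.
(* Fixed points of [phi] solve the equation. The ball of radius 1/2 is preserved because (3/4 +
   1/4)/2 = 1/2, and on it [phi] contracts by 1/2 because y^2 - z^2 = y (y - z) + (y - z) z. *)
pose phi y : A := (2^-1)%:C *: (x + y *c y).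
pose B := [set y : A | nm y <= 2^-1].
have phiB y : B y -> B (phi y).
  rewrite /B/= => yB; rewrite nmZr ?invr_ge0//.
  have := nmD x (y *c y); have := nm_mul y y; have := nm_ge0 y; nra.
have phiC y z : B y -> B z -> nm (phi y - phi z) <= 2^-1 * nm (y - z).
  rewrite /B/= => yB zB; rewrite -scalerBr nmZr ?invr_ge0// ler_pM2l ?invr_gt0//.
  have -> : x + y *c y - (x + z *c z) = y *c (y - z) + (y - z) *c z.
    rewrite opprD addrACA subrr add0r cs_mulDr cs_mulDl cs_mulNr cs_mulNl.
    by rewrite addrA subrK.
  have := nmD (y *c (y - z)) ((y - z) *c z); have := nm_mul y (y - z).
  have := nm_mul (y - z) z; have := nm_ge0 (y - z); nra.
have itB n : B (iter n phi 0).
  by elim: n => [|n IH]; [rewrite /B/= nm0|exact: phiB].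
have itC n : nm (iter n.+1 phi 0 - iter n phi 0) <= 2^-1 ^+ n.
  elim: n => [|n IH]; last first.
    by apply: (le_trans (phiC _ _ (itB n.+1) (itB n))); rewrite exprS ler_pM2l ?invr_gt0.
  rewrite subr0 expr0; apply: le_trans (itB 1%N) _; lra.
pose D (e : R) := [set y | B y /\ nm (phi y - y) < e].
have D0 e : 0 < e -> D e !=set0.
  move=> e0; have := @cvg_geometric R 1 2^-1.
  rewrite ger0_norm ?invr_ge0// => /(_ ltac:(lra)) /cvgrPdist_lt /(_ e e0).
  case=> n _ /(_ n (leqnn n)) /=; rewrite sub0r normrN mul1r.
  rewrite ger0_norm ?exprn_ge0 ?invr_ge0// => ne; exists (iter n phi 0).
  by split; [exact: itB|exact: le_lt_trans (itC n) ne].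
have Dm d e : d <= e -> D d `<=` D e.
  by move=> de y [By yd]; split=> //; apply: lt_le_trans de.
(* The index sets consist of approximate fixed points. By the contraction, two of them with defect
   below d are less than 4 d apart, hence e/4. *)
have [//|//|e e0|y yP] := @complete_family _ A A D id.
  exists (e / 4); first lra.
  move=> y z [By yd] [Bz zd] /=.
  have := nm_dist (phi y) y z; have := nm_dist (phi z) (phi y) z.
  have := phiC y z By Bz; rewrite (nmC y (phi y)); lra.
have yz e : 0 < e -> exists z, [/\ B z, nm (phi z - z) < e & nm (y - z) < e].
  move=> e0; have [d d0 dP] := yP e e0.
  have [|z Dz] := D0 (Num.min d e); first by rewrite lt_min d0.
  exists z; split; first by case: Dz.
    by have [] : D e z by apply: Dm Dz; rewrite ge_min lexx orbT.
  by apply: dP; apply: Dm Dz; rewrite ge_min lexx.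
have yB : B y.
  rewrite /B/=; apply/ler_addgt0Pr => e e0.
  have [z [+ _]] := yz e e0.
  have := nmD (y - z) z; rewrite subrK /B/=; lra.
have phiy : phi y = y.
  apply/eqP; rewrite -subr_eq0; apply/eqP/nm_eq0/eqP; rewrite eq_le nm_ge0 andbT.
  apply/ler_addgt0Pr => e e0; rewrite add0r.
  have [|z [zB zd yz']] := yz (e / 4); first lra.
  have := nm_dist (phi z) (phi y) y; have := nm_dist z (phi z) y.
  have := phiC y z yB zB; rewrite (nmC z y); lra.
(* As [x] is self-adjoint, [phi] commutes with the star, so y^# is another fixed point in the ball
   and the contraction identifies it with [y]. *)
have symy : y^# = y.
  have sp : phi y^# = y^#.
    rewrite -[in RHS]phiy /phi cs_starZ cs_starD cs_starM sx; congr (_ *: _).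
    exact/esym/conjc_real.
  have := phiC y^# y; rewrite /B/= nm_star sp phiy => /(_ yB yB).
  have := nm_ge0 (y^# - y) => h0 h1.
  by apply/eqP; rewrite -subr_eq0; apply/eqP/nm_eq0; lra.
exists y => //.
have : 2%:C *: phi y = x + y *c y by rewrite scalerA -rmorphM divff ?scale1r.
by rewrite phiy => yE; rewrite -[LHS](addrK (y *c y)) -yE rmorphD scalerDl scale1r.
Qed.

End CStarContinuity.

Section BoundedOps.
Context {R : realType}.
Implicit Types X Y Z : normedModType R[i].

Lemma bounded_opP X Y (f : X -> Y) : bounded_op f <->
  linear f /\ exists C : R, forall x, nm (f x) <= C * nm x.
Proof. by split=> -[lf] /(continuous_nmP lf). Qed.

Lemma bounded_op_comp X Y Z (f : Y -> Z) (g : X -> Y) :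
  bounded_op f -> bounded_op g -> bounded_op (f \o g).
Proof.
move=> [lf cf] [lg cg]; split=> [c x y|x] /=; first by rewrite lg lf.
by apply: continuous_comp; [exact: cg|exact: cf].
Qed.

Lemma bounded_opD X Y (f : X -> Y) x y : bounded_op f -> f (x + y) = f x + f y.
Proof. by case=> lf _; have := lf 1 x y; rewrite !scale1r. Qed.

Lemma bounded_op0 X Y (f : X -> Y) : bounded_op f -> f 0 = 0.
Proof. by move=> /bounded_opD fD; apply: (addrI (f 0)); rewrite -fD !addr0. Qed.

Lemma bounded_opZ X Y (f : X -> Y) c x : bounded_op f -> f (c *: x) = c *: f x.
Proof. by move=> bf; have := bf.1 c x 0; rewrite !addr0 (bounded_op0 bf) addr0. Qed.

Lemma bounded_opN X Y (f : X -> Y) x : bounded_op f -> f (- x) = - f x.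
Proof. by move=> bf; rewrite -scaleN1r bounded_opZ ?scaleN1r. Qed.

Lemma bounded_opB X Y (f : X -> Y) x y : bounded_op f -> f (x - y) = f x - f y.
Proof. by move=> bf; rewrite bounded_opD// bounded_opN. Qed.

Lemma bounded_op_sum X Y (f : X -> Y) n (s : 'I_n -> X) : bounded_op f ->
  f (\sum_k s k) = \sum_k f (s k).
Proof.
by move=> bf; exact: (big_morph f (fun x y => bounded_opD x y bf) (bounded_op0 bf)).
Qed.

Lemma bounded_op_cst0 X Y : bounded_op (fun _ : X => 0 : Y).
Proof. by apply/bounded_opP; split=> [c x y|]; [rewrite scaler0 addr0|exists 0 => x; rewrite nm0 mul0r]. Qed.

Lemma the_opP X Y (P : set (X -> Y)) (f : X -> Y) :
  bounded_op f -> P f -> bounded_op (the_op P) /\ P (the_op P).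
Proof. by move=> bf Pf; rewrite /the_op; case: xgetP => [g _ //|/(_ f)] []. Qed.

End BoundedOps.

Section InnerProductTheory.
Context {R : realType} {H : hilbertSpace (R := R)}.
Implicit Types (x y z : H) (c : R[i]).
Local Notation "x %:C" := (real_complex R x) : ring_scope.

Lemma ipDr x y z : hs_ip x (y + z) = hs_ip x y + hs_ip x z.
Proof. by have := hs_ip_linear x 1 y z; rewrite scale1r mul1r. Qed.

Lemma ipZr c x y : hs_ip x (c *: y) = c * hs_ip x y.
Proof. by have := hs_ip_linear x c y 0; rewrite !addr0 hs_ipr0 addr0. Qed.

Lemma ipNr x y : hs_ip x (- y) = - hs_ip x y.
Proof. by rewrite -scaleN1r ipZr mulN1r. Qed.

Lemma ipBr x y z : hs_ip x (y - z) = hs_ip x y - hs_ip x z.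
Proof. by rewrite ipDr ipNr. Qed.

Lemma ipDl x y z : hs_ip (y + z) x = hs_ip y x + hs_ip z x.
Proof. by rewrite -hs_ip_conj ipDr rmorphD /= !hs_ip_conj. Qed.

Lemma ipZl c x y : hs_ip (c *: y) x = c^* * hs_ip y x.
Proof. by rewrite -hs_ip_conj ipZr rmorphM /= hs_ip_conj. Qed.

Lemma ipNl x y : hs_ip (- y) x = - hs_ip y x.
Proof. by rewrite -hs_ip_conj ipNr rmorphN /= hs_ip_conj. Qed.

Lemma ipBl x y z : hs_ip (y - z) x = hs_ip y x - hs_ip z x.
Proof. by rewrite ipDl ipNl. Qed.

Lemma ip0l x : hs_ip 0 x = 0.
Proof. by rewrite -hs_ip_conj hs_ipr0 rmorph0. Qed.

Lemma ip_sumr x n (s : 'I_n -> H) : hs_ip x (\sum_k s k) = \sum_k hs_ip x (s k).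
Proof. exact: (big_morph (hs_ip x) (ipDr x) (hs_ipr0 x)). Qed.

Lemma ip_suml x n (s : 'I_n -> H) : hs_ip (\sum_k s k) x = \sum_k hs_ip (s k) x.
Proof. exact: (big_morph (hs_ip ^~ x) (ipDl x) (ip0l x)). Qed.

Lemma ip_nm x : hs_ip x x = (nm x ^+ 2)%:C.
Proof. by rewrite -hs_norm nmE rmorphXn. Qed.

Lemma nm_ip x : nm x ^+ 2 = complex.Re (hs_ip x x).
Proof. by rewrite ip_nm. Qed.

Lemma nm_sqrD x y :
  nm (x + y) ^+ 2 = nm x ^+ 2 + 2 * complex.Re (hs_ip x y) + nm y ^+ 2.
Proof.
rewrite !nm_ip ipDl !ipDr -(hs_ip_conj x y) !raddfD /=.
by case: (hs_ip x y) => a b /=; ring.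
Qed.

Lemma ip_orth_sym x y : hs_ip x y = 0 -> hs_ip y x = 0.
Proof. by move=> xy; rewrite -hs_ip_conj xy rmorph0. Qed.

Lemma ip_self0 x : hs_ip x x = 0 -> x = 0.
Proof. by rewrite ip_nm => /complexI/eqP; rewrite sqrf_eq0 => /eqP/nm_eq0. Qed.

Lemma ip_ext x y : (forall z, hs_ip x z = hs_ip y z) -> x = y.
Proof.
by move=> xy; apply/eqP; rewrite -subr_eq0; apply/eqP/ip_self0; rewrite ipBl xy subrr.
Qed.

Lemma nm_CS x y : nm (hs_ip x y : R[i]^o) <= nm x * nm y.
Proof. by rewrite -lecR rmorphM /= -!nmE; exact: hs_ip_CauchySchwarz. Qed.

Lemma re_CS x y : complex.Re (hs_ip x y) <= nm x * nm y.
Proof.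
apply: le_trans (nm_CS x y); rewrite -lecR -nmE.
apply: le_trans (normc_ge_Re _); rewrite lecR; exact: ler_norm.
Qed.

End InnerProductTheory.

Section RepContinuity.
Context {R : realType} {A : cstarAlgebra R} {H : hrep A}.
Local Notation "x %:C" := (real_complex R x) : ring_scope.

Lemma hr_actDl (a b : A) (h : H) : hr_act (a + b) h = hr_act a h + hr_act b h.
Proof. by have := hr_act_linear h 1 a b; rewrite /= !scale1r. Qed.

Lemma hr_act0l (h : H) : hr_act (0 : A) h = 0.
Proof. by apply: (addrI (hr_act 0 h)); rewrite -hr_actDl !addr0. Qed.

Lemma hr_actZl c (a : A) (h : H) : hr_act (c *: a) h = c *: hr_act a h.
Proof. by have := hr_act_linear h c a 0; rewrite /= !addr0 hr_act0l addr0. Qed.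

Lemma hr_actBl (a b : A) (h : H) : hr_act (a - b) h = hr_act a h - hr_act b h.
Proof. by rewrite hr_actDl -scaleN1r hr_actZl scaleN1r. Qed.

Lemma hr_act_adjr (a : A) (h k : H) : hs_ip h (hr_act a k) = hs_ip (hr_act a^# h) k.
Proof. by rewrite hr_act_adj cs_starK. Qed.

(* Continuity in [a] is automatic: if b^# b = y + y - y^2 with y self-adjoint *)
(* (for a small multiple b of a), then |b h|^2 = |h|^2 - |h - y h|^2.         *)
Lemma nm_hr_act (a : A) (h : H) : nm (hr_act a h) <= 2 * nm a * nm h.
Proof.
have [->|a0] := eqVneq a 0; first by rewrite hr_act0l !nm0 mulr0 mul0r.
have na : 0 < nm a.
  by rewrite lt_neqAle nm_ge0 andbT; apply: contra_neq a0 => /esym/nm_eq0.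
(* Scaling [a] to norm 1/2 gives |b^# b| = 1/4, within the reach of [sqrt_fixpoint]; the price is
   the factor 2 in the bound. *)
pose t := (2 * nm a)^-1; have t0 : 0 < t by rewrite invr_gt0 mulr_gt0.
pose b : A := t%:C *: a.
suff : nm (hr_act b h) <= nm h.
  rewrite /b hr_actZl nmZr ?(ltW t0)// /t ler_pdivrMl ?mulr_gt0//.
have nb : nm b = 2^-1.
  by rewrite /b nmZr ?(ltW t0)// /t invfM -mulrA mulVf ?mulr1// gt_eqF.
have [||y ys xy] := @sqrt_fixpoint R A (b^# *c b).
- by rewrite nm_star_mul nb; lra.
- by rewrite cs_starM cs_starK.
rewrite -ler_sqr ?nnegrE ?nm_ge0//.
have -> : nm (hr_act b h) ^+ 2 = nm h ^+ 2 - nm (h - hr_act y h) ^+ 2.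
  rewrite !nm_ip hr_act_adj -hr_actM xy hr_actBl hr_actDl hr_actM.
  rewrite ipBl !ipBr !ipDr !(hr_act_adjr y h) ys -raddfB /=.
  by congr complex.Re; ring.
by rewrite gerBl exprn_ge0 ?nm_ge0.
Qed.

End RepContinuity.

(** * Projections, adjoints and isometries *)

Section Projection.
Context {R : realType}.
Local Notation "x %:C" := (real_complex R x) : ring_scope.

Lemma reN (c : R[i]) : complex.Re (- c) = - complex.Re c.
Proof. by case: c. Qed.

Lemma closed_nmP (X : normedModType R[i]) (S : set X) :
  (forall x, (forall e : R, 0 < e -> exists2 y, S y & nm (x - y) < e) -> S x) ->
  closed S.
Proof. by move=> SP x /closure_nmP /SP. Qed.

Lemma nm_small0 (X : normedModType R[i]) (x : X) (K : R) :
  (forall e : R, 0 < e -> nm x <= K * e) -> x = 0.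
Proof.
move=> xK; apply/nm_eq0/eqP; rewrite eq_le nm_ge0 andbT.
apply/ler_addgt0Pr => e e0; rewrite add0r.
have K0 : 0 < `|K| + 1 by have := normr_ge0 K; lra.
apply: le_trans (xK (e / (`|K| + 1)) _) _; first exact: divr_gt0.
rewrite mulrCA ger_pMr// ler_pdivrMr// mul1r; have := ler_norm K; lra.
Qed.

Lemma closed_subspace_eq (X Y : normedModType R[i]) (f g : X -> Y) :
  bounded_op f -> bounded_op g -> closed_subspace [set x | f x = g x].
Proof.
move=> bf bg; split=> /=; last first.
- by move=> c x y fgx fgy; rewrite bf.1 bg.1 fgx fgy.
- by rewrite (bounded_op0 bf) (bounded_op0 bg).
have [[_ [C fC]] [_ [D gD]]] := ((bounded_opP f).1 bf, (bounded_opP g).1 bg).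
apply: closed_nmP => x xS /=; apply/eqP; rewrite -subr_eq0; apply/eqP.
apply: (@nm_small0 _ _ (`|C| + `|D|)) => e e0.
have [y /= fgy xy] := xS e e0.
have -> : f x - g x = f (x - y) - g (x - y).
  by rewrite (bounded_opB _ _ bf) (bounded_opB _ _ bg) fgy opprB addrA subrK.
apply: le_trans (nmD _ _) _; rewrite nmN mulrDl; apply: lerD.
  apply: le_trans (fC _) _; apply: (@le_trans _ _ (`|C| * nm (x - y))).
    by rewrite ler_wpM2r ?nm_ge0 ?ler_norm.
  by rewrite ler_wpM2l// ltW.
apply: le_trans (gD _) _; apply: (@le_trans _ _ (`|D| * nm (x - y))).
  by rewrite ler_wpM2r ?nm_ge0 ?ler_norm.
by rewrite ler_wpM2l// ltW.
Qed.

Lemma closed_subspace_linspan (X : normedModType R[i]) (S : set X) :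
  closed_subspace (closure (linspan S)).
Proof.
split=> [||c x y /closure_nmP Sx /closure_nmP Sy]; first exact: closed_closure.
  apply: subset_closure; exists 0%N, (fun=> 0), (fun=> 0).
  by split=> [[]//|]; rewrite big_ord0.
apply/closure_nmP => e e0.
pose K := complex.Re `|c| + 1.
have K0 : 0 < K.
  by rewrite ltr_pwDr// -ler0c RRe_real ?ger0_real.
have [_ [n [a [s [Ss ->]]]] xs] := Sx (e / 2 / K) ltac:(by rewrite !divr_gt0).
have [_ [m [b [t [St ->]]]] yt] := Sy (e / 2) ltac:(by rewrite divr_gt0).
exists (c *: (\sum_k a k *: s k) + \sum_k b k *: t k).
  exists (n + m)%N, (fun k => match fintype.split k with inl k => c * a k | inr k => b k end).
  exists (fun k => match fintype.split k with inl k => s k | inr k => t k end).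
  split=> [k|]; first by case: (fintype.split k).
  rewrite big_split_ord/= scaler_sumr; congr (_ + _).
    by apply: eq_bigr => k _; case: splitP => [l /= /ord_inj <-|l /= kE];
      [rewrite scalerA|have := ltn_ord k; rewrite kE ltnNge leq_addr].
  apply: eq_bigr => k _; case: splitP => [l /= kE|l /= /addnI/ord_inj <-//].
  by have := ltn_ord l; rewrite -kE ltnNge leq_addr.
rewrite opprD addrACA -scalerBr.
apply: le_lt_trans (nmD _ _) _; rewrite nmZ [ltRHS](splitr e).
apply: ltr_leD => //; last exact: ltW.
set u := nm _ in xs *; have u0 : 0 <= u by exact: nm_ge0.
apply: (@le_lt_trans _ _ (K * u)); first by rewrite ler_wpM2r// lerDl.
by rewrite mulrC -ltr_pdivlMr.
Qed.

Lemma sub_closure_linspan (X : normedModType R[i]) (S N : set X) :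
  closed_subspace N -> S `<=` N -> closure (linspan S) `<=` N.
Proof.
move=> [cN N0 Nl] SN; rewrite closureE; apply: smallest_sub => //.
move=> _ [n [c [s [Ss ->]]]].
elim: n c s Ss => [|n IH] c s Ss; first by rewrite big_ord0.
by rewrite big_ord_recl; apply: Nl; [exact: SN|apply: IH => k; exact: Ss].
Qed.

Lemma mem_linspan (X : normedModType R[i]) (S : set X) x : S x -> linspan S x.
Proof.
move=> Sx; exists 1%N, (fun=> 1), (fun=> x).
by split=> //; rewrite big_ord1 scale1r.
Qed.

(** Apply the hypothesis to [hs_ip m z *: m]: its inner product with [z] is |<m,z>|^2, already
    real. *)
Lemma ip_re0 (H : hilbertSpace (R := R)) (N : set H) z :
  (forall (c : R[i]) m, N m -> N (c *: m)) ->
  (forall m, N m -> complex.Re (hs_ip m z) = 0) ->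
  forall m, N m -> hs_ip m z = 0.
Proof.
move=> Nl Nz m Nm; have := Nz _ (Nl (hs_ip m z) m Nm).
rewrite ipZl mulrC -normCK nmE -rmorphXn /= => /eqP; rewrite sqrf_eq0 => /eqP.
by move=> /(@nm_eq0 _ R[i]^o).
Qed.

(** Near-minimizers of the distance to [x] cluster, by the parallelogram law. Orthogonality is
    proved approximately for near-minimizers and carried to their limit [p]. *)
Lemma projection (H : hilbertSpace (R := R)) (N : set H) x :
  closed_subspace N -> exists2 p, N p & forall m, N m -> hs_ip m (x - p) = 0.
Proof.
move=> [cN N0 Nl].
have NZ (c : R[i]) m : N m -> N (c *: m) by move=> Nm; rewrite -[_ *: m]addr0; apply: Nl.
have ND a b : N a -> N b -> N (a + b).
  by move=> Na Nb; rewrite -[a]scale1r; apply: Nl.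
pose Q := [set nm (x - n) ^+ 2 | n in N].
have hQ : has_inf Q.
  split; first by exists (nm (x - 0) ^+ 2), 0.
  by exists 0 => _ [n _ <-]; rewrite exprn_ge0 ?nm_ge0.
pose d := inf Q.
have dN n : N n -> d <= nm (x - n) ^+ 2 by move=> Nn; apply: (ge_inf hQ.2); exists n.
pose D (e : R) := [set n | N n /\ nm (x - n) ^+ 2 < d + e].
have D0 e : 0 < e -> D e !=set0.
  by move=> e0; have [_ [n Nn <-] ne] := inf_adherent e0 hQ; exists n.
(* |a-b|^2 = 2|x-a|^2 + 2|x-b|^2 - 4|x-(a+b)/2|^2, where the midpoint lies in [N] and so contributes
   at least 4 d. *)
have par e a b : D e a -> D e b -> nm (a - b) ^+ 2 <= 4 * e.
  move=> [Na ae] [Nb be].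
  have -> : a - b = (x - b) - (x - a) by rewrite opprB [RHS]addrC addrA subrK.
  have := nm_sqrD (x - b) (- (x - a)); have := nm_sqrD (x - b) (x - a).
  rewrite ipNr reN nmN.
  have -> : (x - b) + (x - a) = 2%:C *: (x - (2^-1)%:C *: (a + b)).
    rewrite scalerBr scalerA -rmorphM divff// scale1r rmorphD /= scalerDl scale1r.
    by rewrite opprD addrACA (addrC (- b)).
  rewrite nmZr// exprMn.
  have := dN _ (NZ (2^-1)%:C _ (ND _ _ Na Nb)); lra.
have [//||e e0|p pP] := @complete_family _ H H D id.
- by move=> e1 e2 e12 y [Ny ye]; split=> //; apply: lt_le_trans ye _; rewrite lerD2l.
- exists (e ^+ 2 / 8); first by rewrite divr_gt0// exprn_gt0.
  move=> a b Da Db /=; rewrite -ltr_sqr ?nnegrE ?nm_ge0 ?ltW//.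
  apply: le_lt_trans (par _ _ _ Da Db) _.
  have : 0 < e ^+ 2 by rewrite exprn_gt0.
  lra.
have pN e : 0 < e -> exists a, D e a /\ nm (p - a) < e.
  move=> e0; have [d' d0 dP] := pP e e0.
  have [|a [Na ax]] := D0 (Num.min d' e); first by rewrite lt_min d0.
  exists a; split.
    by split=> //; apply: lt_le_trans ax _; rewrite lerD2l ge_min lexx orbT.
  by apply: dP; split=> //; apply: lt_le_trans ax _; rewrite lerD2l ge_min lexx.
exists p; first by apply: cN; apply/closure_nmP => e e0; have [a [[Na _] ap]] := pN e e0; exists a.
apply: ip_re0 => // m Nm; apply/eqP.
pose r u := complex.Re (hs_ip u m).
have rE u : complex.Re (hs_ip m u) = r u by rewrite /r -(hs_ip_conj m u); case: (hs_ip m u).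
rewrite rE; apply/negP => /negP r0.
have M0 := nm_ge0 m; set M := nm m in M0.
(* the quadratic t |-> nm (x - a - t m)^2 - d is nonnegative *)
have quad e a : D e a -> r (x - a) ^+ 2 <= e * M ^+ 2.
  move=> [Na ae].
  have q t : 0 <= e - 2 * t * r (x - a) + t ^+ 2 * M ^+ 2.
    have := dN _ (Nl t%:C _ _ Nm Na).
    rewrite opprD addrCA addrC nm_sqrD ipNr reN nmN ipZr nmZ exprMn.
    have -> : complex.Re `|t%:C| ^+ 2 = t ^+ 2.
      by rewrite normc_def /= expr0n addr0 sqr_sqrtr ?sqr_ge0.
    have -> : complex.Re (t%:C * hs_ip (x - a) m) = t * r (x - a).
      by rewrite /r; case: (hs_ip _ _) => u v /=; rewrite mul0r subr0.
    move: ae; rewrite -/M; lra.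
  have [M00|M00] := eqVneq M 0.
    have e0 : 0 <= e by have := dN a Na; lra.
    rewrite M00 expr0n mulr0; have := re_CS (x - a) m; have := re_CS (x - a) (- m).
    by rewrite ipNr reN nmN -/M M00 mulr0 -/(r (x - a)) => h1 h2; nra.
  have M2 : 0 < M ^+ 2 by rewrite exprn_gt0// lt_neqAle eq_sym M00.
  (* This is the minimum point of the quadratic. *)
  have := q (r (x - a) / M ^+ 2); set s := r (x - a) => h.
  have : 0 <= (e - 2 * (s / M ^+ 2) * s + (s / M ^+ 2) ^+ 2 * M ^+ 2) * M ^+ 2.
    by rewrite mulr_ge0// ltW.
  have -> : (e - 2 * (s / M ^+ 2) * s + (s / M ^+ 2) ^+ 2 * M ^+ 2) * M ^+ 2 =
    e * M ^+ 2 - s ^+ 2 by field.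
  by rewrite subr_ge0.
have rp : 0 < r (x - p) ^+ 2 by rewrite exprn_even_gt0.
(* For e <= 1 both r(x-a)^2 and r(a-p)^2 are at most e M^2, so r(x-p)^2 <= 4 e M^2; this [e] makes
   that bound smaller than r(x-p)^2, a contradiction. *)
pose e := Num.min 1 (r (x - p) ^+ 2 / (8 * (M ^+ 2 + 1))).
have M2 : 0 <= M ^+ 2 by rewrite exprn_ge0.
have K0 : 0 < 8 * (M ^+ 2 + 1) by lra.
have e0 : 0 < e by rewrite lt_min ltr01 divr_gt0.
have [a [Da pa]] := pN e e0.
have ra : r (x - p) = r (x - a) + r (a - p) by rewrite /r -raddfD -ipDl addrA subrK.
have rb : r (a - p) ^+ 2 <= e ^+ 2 * M ^+ 2.
  have h1 := re_CS (a - p) m; have := re_CS (a - p) (- m).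
  rewrite ipNr reN nmN => h2; rewrite -exprMn.
  rewrite (nmC p a) in pa; rewrite -/M -/(r (a - p)) in h1 h2.
  have h3 : nm (a - p) * M <= e * M by rewrite ler_wpM2r// ltW.
  have : 0 <= (e * M - r (a - p)) * (e * M + r (a - p)).
    by rewrite mulr_ge0//; lra.
  by rewrite -subr_sqr subr_ge0.
have qa := quad e a Da.
have e1 : e <= 1 by rewrite ge_min lexx.
have e2 : e * (8 * (M ^+ 2 + 1)) <= r (x - p) ^+ 2.
  by rewrite -ler_pdivlMr// ge_min lexx orbT.
have : r (x - p) ^+ 2 <= 2 * r (x - a) ^+ 2 + 2 * r (a - p) ^+ 2.
  by rewrite ra -subr_ge0; have := sqr_ge0 (r (x - a) - r (a - p)); nra.
have : e ^+ 2 * M ^+ 2 <= e * M ^+ 2.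
  by rewrite ler_wpM2r// expr2 ger_pMr.
have : 0 <= e * M ^+ 2 by rewrite mulr_ge0// ltW.
lra.
Qed.

End Projection.

Section Isometries.
Context {R : realType}.
Local Notation "x %:C" := (real_complex R x) : ring_scope.
Local Notation hilb := (hilbertSpace (R := R)).
Implicit Types X Y Z H : hilb.

Lemma closed_subspace_orth X (S : set X) :
  closed_subspace [set x | forall y, S y -> hs_ip y x = 0].
Proof.
split=> [|y _|c x z xS zS y Sy] /=; last 2 first.
- by rewrite hs_ipr0.
- by rewrite ipDr ipZr xS// zS// mulr0 addr0.
have -> : [set x | forall y, S y -> hs_ip y x = 0] =
    \bigcap_(y in S) [set x | hs_ip y x = 0].
  by apply/seteqP; split=> x xS y; exact: xS.
apply: closed_bigI => y _.
have -> : [set x | hs_ip y x = 0] = [set x | hs_ip x y = 0].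
  by apply/seteqP; split=> x /=; exact: ip_orth_sym.
exact: closed_orth.
Qed.

Lemma total_setP X (S : set X) :
  total_set S <-> forall x, (forall y, S y -> hs_ip y x = 0) -> x = 0.
Proof.
split=> [tS x xS|tS].
  by apply: hs_ip_total tS _ => y Sy; apply: ip_orth_sym; exact: xS.
apply/seteqP; split=> // x _.
have [p Sp px] := projection x (closed_subspace_linspan S).
suff /eqP : x - p = 0 by rewrite subr_eq0 => /eqP ->.
by apply: tS => y Sy; apply: px; apply: subset_closure; exact: mem_linspan.
Qed.

(** With [p] the projection, [x - p] is orthogonal to [N], hence to [x] by hypothesis and to [p],
    hence to itself. *)
Lemma orthogonal_closure X (N : set X) x : closed_subspace N ->
  (forall z, (forall m, N m -> hs_ip m z = 0) -> hs_ip z x = 0) -> N x.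
Proof.
move=> cN xN; have [p Np px] := projection x cN.
suff /eqP : x - p = 0 by rewrite subr_eq0 => /eqP ->.
by apply: ip_self0; rewrite ipBr (xN _ px) (ip_orth_sym (px _ Np)) subrr.
Qed.

Lemma riesz X (phi : X -> R[i]^o) : bounded_op phi ->
  exists y, forall x, phi x = hs_ip y x.
Proof.
move=> bphi; have [phi0|] := pselect (forall x, phi x = 0).
  by exists 0 => x; rewrite ip0l phi0.
move=> /existsNP [x0 /eqP phix0].
pose N := [set x | phi x = 0].
have cN : closed_subspace N := closed_subspace_eq bphi (bounded_op_cst0 _ _).
have [p Np pz] := projection x0 cN.
set z := x0 - p in pz.
have phiz : phi z != 0 by rewrite (bounded_opB _ _ bphi) [phi p]Np subr0.
have zz : hs_ip z z != 0.
  apply: contra_neq phiz => /ip_self0 ->; exact: bounded_op0.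
exists ((phi z / hs_ip z z)^* *: z) => x.
(* This combination lies in the kernel of [phi], to which [z] is orthogonal; solving for [phi x]
   produces the representing vector. *)
have : hs_ip (phi z *: x - phi x *: z) z = 0.
  apply: pz; rewrite /N/= (bounded_opB _ _ bphi) (bounded_opZ _ _ bphi).
  by rewrite (bounded_opZ _ _ bphi) /GRing.scale /= mulrC subrr.
move=> /ip_orth_sym; rewrite ipBr !ipZr => /eqP; rewrite subr_eq0 => /eqP xz.
rewrite ipZl; have -> : ((phi z / hs_ip z z)^*)^* = phi z / hs_ip z z by exact: conjCK.
by rewrite mulrAC xz mulfK.
Qed.

(** Riesz gives the adjoint [g] pointwise. It is bounded because |g y|^2 = <y, f (g y)>. *)
Lemma adjopP X Y (f : X -> Y) : bounded_op f ->
  bounded_op (adjop f) /\ forall x y, hs_ip (f x) y = hs_ip x (adjop f y).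
Proof.
move=> bf.
have /choice [g gP] : forall y : Y, exists z : X, forall x, hs_ip y (f x) = hs_ip z x.
  by move=> y; apply: riesz (bounded_op_comp (hs_ip_bounded y) bf).
have [_ [C fC]] := (bounded_opP f).1 bf.
apply: (@the_opP _ Y X _ g); last by move=> x y; rewrite -hs_ip_conj gP hs_ip_conj.
apply/bounded_opP; split=> [c y z|].
  by apply: ip_ext => x; rewrite -gP ipDl ipZl !gP -ipZl -ipDl.
exists `|C| => y.
have [->|g0] := eqVneq (g y) 0.
  by rewrite nm0 mulr_ge0 ?nm_ge0.
have gp : 0 < nm (g y).
  by rewrite lt_neqAle nm_ge0 andbT; apply: contra_neq g0 => /esym/nm_eq0.
rewrite -(ler_pM2r gp) -expr2 nm_ip -gP.
apply: le_trans (re_CS _ _) _; rewrite mulrC mulrAC ler_wpM2r ?nm_ge0//.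
by apply: le_trans (fC _) _; rewrite ler_wpM2r ?nm_ge0 ?ler_norm.
Qed.

(** Linearity comes for free: f (c x + y) - (c f x + f y) is orthogonal to every value of [f], hence
    to itself. *)
Lemma isometry_of_ip X Y (f : X -> Y) :
  (forall x y, hs_ip (f x) (f y) = hs_ip x y) -> isometry f.
Proof.
move=> fip; have fn x : nm (f x) = nm x.
  by apply/eqP; rewrite -(eqrXn2 (n := 2)) ?nm_ge0// !nm_ip fip.
split; last by move=> x; rewrite !nmE fn.
apply/bounded_opP; split=> [c x y|]; last by exists 1 => x; rewrite fn mul1r.
apply/eqP; rewrite -subr_eq0; apply/eqP/ip_self0.
set w := _ - _; suff: forall z, hs_ip w (f z) = 0.
  by move=> h; rewrite {2}/w ipBr ipDr ipZr !h mulr0 addr0 subrr.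
by move=> z; rewrite /w ipBl ipDl ipZl !fip ipDl ipZl subrr.
Qed.

Lemma isometry_bounded X Y (f : X -> Y) : isometry f -> bounded_op f.
Proof. by case. Qed.

Lemma isometry_nm X Y (f : X -> Y) x : isometry f -> nm (f x) = nm x.
Proof. by move=> [_ fn]; rewrite /nm fn. Qed.

(** Polarization gives the real parts; replacing [x] by i x gives the imaginary parts. *)
Lemma isometry_ip X Y (f : X -> Y) x y : isometry f ->
  hs_ip (f x) (f y) = hs_ip x y.
Proof.
move=> fi; have bf := isometry_bounded fi.
have re u v : complex.Re (hs_ip (f u) (f v)) = complex.Re (hs_ip u v).
  have := nm_sqrD (f u) (f v); rewrite -(bounded_opD _ _ bf) !(isometry_nm _ fi).
  by rewrite nm_sqrD; lra.
have := re ('i *: x) y; rewrite (bounded_opZ _ _ bf) !ipZl; have := re x y.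
have -> : 'i^* = - 'i%C :> R[i] by apply/eqP; rewrite eq_complex /= !oppr0 !eqxx.
case: (hs_ip (f x) (f y)) (hs_ip x y) => [a b] [c d] /= -> h.
by congr Complex; move: h; rewrite !oppr0 !mul0r !sub0r !mulN1r !opprK.
Qed.

Lemma isometry_inj X Y (f : X -> Y) : isometry f -> injective f.
Proof.
move=> fi x y fxy; apply/eqP; rewrite -subr_eq0; apply/eqP/nm_eq0.
rewrite -(isometry_nm _ fi) (bounded_opB _ _ (isometry_bounded fi)) fxy subrr.
exact: nm0.
Qed.

Lemma isometry_comp X Y Z (f : Y -> Z) (g : X -> Y) :
  isometry f -> isometry g -> isometry (f \o g).
Proof.
by move=> fi gi; apply: isometry_of_ip => x y /=; rewrite (isometry_ip _ _ fi) (isometry_ip _ _ gi).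
Qed.

Lemma isometry_adjK X Y (f : X -> Y) : isometry f -> cancel f (adjop f).
Proof.
move=> fi x; apply: ip_ext => z; have [_ fa] := adjopP (isometry_bounded fi).
by rewrite -hs_ip_conj -fa (isometry_ip _ _ fi) hs_ip_conj.
Qed.

Lemma isometry_range_closed X Y (f : X -> Y) :
  isometry f -> closed_subspace (range f).
Proof.
move=> fi; have bf := isometry_bounded fi.
have -> : range f = [set y | f (adjop f y) = y].
  by apply/seteqP; split=> [_ [x _ <-]|y <-] /=; [rewrite isometry_adjK|exists (adjop f y)].
apply: (@closed_subspace_eq _ _ _ (f \o adjop f) id).
  by apply: bounded_op_comp => //; case: (adjopP bf).
by split=> // x; exact: cvg_id.
Qed.

Lemma isometry_onto_total X Y (f : X -> Y) (S : set Y) :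
  isometry f -> total_set S -> S `<=` range f -> forall y, range f y.
Proof.
move=> fi tS Sf y; have : closure (linspan S) y by rewrite tS.
exact: sub_closure_linspan (isometry_range_closed fi) Sf _.
Qed.

(** Carries Gram identities to limits; both vectors have to be approximated along the same index
    [c]. *)
Lemma ip_approx X Y (x z : X) (y w : Y) (I : Type) (u : I -> X) (v : I -> Y) :
  (forall e : R, 0 < e -> exists c, nm (x - u c) < e /\ nm (y - v c) < e) ->
  (forall c, hs_ip (u c) z = hs_ip (v c) w) -> hs_ip x z = hs_ip y w.
Proof.
move=> xy uv; apply/eqP; rewrite -subr_eq0; apply/eqP.
apply: (@nm_small0 _ R[i]^o _ (nm z + nm w)) => e e0.
have [c [xc yc]] := xy e e0.
have -> : hs_ip x z - hs_ip y w = hs_ip (x - u c) z - hs_ip (y - v c) w :> R[i]^o.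
  by rewrite !ipBl uv opprB addrA subrK.
apply: le_trans (nmD (_ : R[i]^o) _) _; rewrite nmN mulrDl; apply: lerD.
  by apply: le_trans (nm_CS _ _) _; rewrite mulrC ler_wpM2l ?nm_ge0// ltW.
by apply: le_trans (nm_CS _ _) _; rewrite mulrC ler_wpM2l ?nm_ge0// ltW.
Qed.

(* Equality of Gram matrices makes [p a |-> f a] well defined on linear       *)
(* combinations.                                                              *)
Lemma isometry_extension X Y (I : Type) (p : I -> X) (f : I -> Y) :
  total_set (range p) ->
  (forall a b, hs_ip (f a) (f b) = hs_ip (p a) (p b)) ->
  exists L : X -> Y, isometry L /\ forall a, L (p a) = f a.
Proof.
move=> tp fp.
(* Codes of formal linear combinations. A vector may have several codes; [uvB] shows that this does
   no harm. *)
pose J := {n : nat & (('I_n -> R[i]) * ('I_n -> I))%type}.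
pose u (c : J) := \sum_k (projT2 c).1 k *: p ((projT2 c).2 k).
pose v (c : J) := \sum_k (projT2 c).1 k *: f ((projT2 c).2 k).
have uv c d : hs_ip (v c) (v d) = hs_ip (u c) (u d).
  rewrite /u /v !ip_suml; apply: eq_bigr => k _; rewrite !ipZl !ip_sumr.
  by congr (_ * _); apply: eq_bigr => l _; rewrite !ipZr fp.
have uvB c d : nm (v c - v d) = nm (u c - u d).
  by apply/eqP; rewrite -(eqrXn2 (n := 2)) ?nm_ge0// !nm_ip !ipBl !ipBr !uv.
have du x e : 0 < e -> exists c, nm (x - u c) < e.
  move=> e0; have /closure_nmP/(_ e e0) : closure (linspan (range p)) x by rewrite tp.
  move=> [_ [n [c [s [Ss ->]]]] xe].
  have /choice [t ts] : forall k, exists a, p a = s k.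
    by move=> k; have [a _ <-] := Ss k; exists a.
  exists (existT _ n (c, t)); rewrite /u /=.
  by under eq_bigr => k _ do rewrite ts.
(* [L x] is the limit of [v c] over the codes [c] with [u c] close to [x]. *)
have /choice [L LP] : forall x, exists y, forall e, 0 < e ->
    exists2 d, 0 < d & forall c, nm (x - u c) < d -> nm (y - v c) < e.
  move=> x; apply: (@complete_family _ _ J (fun e => [set c | nm (x - u c) < e]) v).
  - by move=> e /(du x).
  - by move=> d e de c /= xd; apply: lt_le_trans de.
  - move=> e e0; exists (e / 2); first by rewrite divr_gt0.
    move=> c d /= xc xd; rewrite uvB; have := nm_dist x (u c) (u d).
    rewrite (nmC (u c) x); lra.
have apx x e : 0 < e -> exists c, nm (x - u c) < e /\ nm (L x - v c) < e.
  move=> e0; have [d d0 dP] := LP x e e0.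
  have [|c xc] := du x (Num.min d e); first by rewrite lt_min d0.
  move: xc; rewrite lt_min => /andP [xd xe]; exists c; split=> //; exact: dP.
exists L; split.
  apply: isometry_of_ip => x y; apply/esym/(ip_approx (apx x)) => c.
  rewrite -hs_ip_conj -[RHS]hs_ip_conj; congr (_^*).
  by apply: (ip_approx (apx y)) => d; rewrite uv.
move=> a; apply/eqP; rewrite -subr_eq0; apply/eqP; apply: (@nm_small0 _ _ _ 1) => e e0.
have [d d0 dP] := LP (p a) e e0.
have := dP (existT _ 1%N (fun=> 1, fun=> a)).
rewrite /u /v /= !big_ord1 !scale1r subrr nm0 mul1r => /(_ d0)/ltW; exact.
Qed.

End Isometries.

Lemma closed_subspace_preimage (R : realType) (X Y : normedModType R[i])
    (f : X -> Y) (N : set Y) :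
  bounded_op f -> closed_subspace N -> closed_subspace (f @^-1` N).
Proof.
move=> bf [cN N0 Nl]; split => [||c x y] /=.
- by apply: preimage_closed cN => x _; exact: bf.2.
- by rewrite (bounded_op0 bf).
- by rewrite bf.1; exact: Nl.
Qed.

(** * Tensor products of operators *)

Section Tensors.
Context {R : realType} {A : cstarAlgebra R} (T : tensorCalculus A).
Implicit Types (E F : corr A) (H K G : hrep A).

Definition intertwines {H K} (J : H -> K) : Prop :=
  forall a h, J (hr_act a h) = hr_act a (J h).

Lemma rangeE (X Y Z : Type) (f : X -> Y -> Z) :
  [set z | exists x y, z = f x y] = range (fun p => f p.1 p.2).
Proof.
apply/seteqP; split=> [_ [x [y ->]]|_ [[x y] _ <-]]; first by exists (x, y).
by exists x, y.
Qed.

Lemma htens_total E H : total_set (range (fun p : E * H => htens T p.1 p.2)).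
Proof.
rewrite -(rangeE (fun (x : E) (h : H) => htens T x h)).
exact (rt_total (tc_rep T E H)).
Qed.

Lemma htens_ext E H (Y : normedModType R[i]) (f g : tc_rep T E H -> Y) :
  bounded_op f -> bounded_op g ->
  (forall x h, f (htens T x h) = g (htens T x h)) -> f =1 g.
Proof.
move=> bf bg fg; apply: (total_eq (rt_total (tc_rep T E H)) bf bg) => _ [x [h ->]].
exact: fg.
Qed.

Lemma nm_htens E H (x : E) (h : H) : nm (htens T x h) <= 2 * nm x * nm h.
Proof.
have nx := nm_ge0 x; have nh := nm_ge0 h.
rewrite -ler_sqr ?nnegrE ?nm_ge0// ?mulr_ge0// nm_ip rt_ip.
apply: le_trans (re_CS _ _) _.
have : nm (hm_ip x x) = nm x ^+ 2.
  by apply: complexI; rewrite -nmE -hm_norm nmE rmorphXn.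
have := nm_hr_act (hm_ip x x) h => + xx; rewrite xx => le.
apply: le_trans (ler_wpM2l nh le) _.
have -> : nm h * (2 * nm x ^+ 2 * nm h) = 2 * (nm x * nm h) ^+ 2 by ring.
have -> : (2 * nm x * nm h) ^+ 2 = 4 * (nm x * nm h) ^+ 2 by ring.
by rewrite ler_wpM2r ?exprn_ge0 ?mulr_ge0// ler_nat.
Qed.

Lemma htens_boundedl E H (h : H) : bounded_op (fun x : E => htens T x h).
Proof.
apply/bounded_opP; split; first exact: rt_linearl.
by exists (2 * nm h) => x; rewrite mulrAC nm_htens.
Qed.

Lemma htens_boundedr E H (x : E) : bounded_op (fun h : H => htens T x h).
Proof.
apply/bounded_opP; split; first exact: rt_linearr.
by exists (2 * nm x) => h; rewrite nm_htens.
Qed.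

Lemma total_htens E H (S : set E) : total_set S ->
  total_set [set z : tc_rep T E H | exists2 x, S x & exists h, z = htens T x h].
Proof.
move=> tS; apply/total_setP => z zS.
apply: hs_ip_total (rt_total _) _ => _ [x [h ->]].
apply: (total_eq tS (f := fun x => hs_ip z (htens T x h) : R[i]^o)
  (g := fun=> 0)); last 1 first.
- by move=> y Sy; apply/ip_orth_sym/zS; exists y => //; exists h.
- exact: (bounded_op_comp (hs_ip_bounded z) (htens_boundedl E h)).
- exact: bounded_op_cst0.
Qed.

(** The hypothesis says that [f] has the Gram matrix of the elementary tensors, so
    [isometry_extension] applies. *)
Lemma tens_liftP E H K (f : E -> H -> K) :
  (forall x h y k,
     hs_ip (f x h) (f y k) = hs_ip h (hr_act (hm_ip x y) k)) ->
  isometry (tens_lift (T := T) f) /\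
  forall x h, tens_lift (T := T) f (htens T x h) = f x h.
Proof.
move=> fip.
have [|L [iL Lf]] := isometry_extension (f := fun p => f p.1 p.2) (@htens_total E H).
  by move=> [x h] [y k] /=; rewrite rt_ip fip.
have {}Lf x h : L (htens T x h) = f x h := Lf (x, h).
have [bT Tf] := the_opP (P := [set L : tc_rep T E H -> K |
  forall x h, L (htens T x h) = f x h]) (isometry_bounded iL) Lf.
(* The selected operator agrees with [L] on elementary tensors, so it is [L] and inherits the
   isometry property. *)
split=> //; have <- : L = tens_lift (T := T) f; last by [].
by apply/funext/htens_ext => //; [exact: isometry_bounded|move=> x h; rewrite Lf; exact/esym/Tf].
Qed.

Lemma id_tensP E H K (J : H -> K) : isometry J -> intertwines J ->
  isometry (id_tens T E J) /\
  forall x h, id_tens T E J (htens T x h) = htens T x (J h).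
Proof.
move=> iJ aJ; apply: tens_liftP => x h y k.
by rewrite rt_ip -aJ (isometry_ip _ _ iJ).
Qed.

Lemma id_tens_act E H K (J : H -> K) : isometry J -> intertwines J ->
  intertwines (id_tens T E J).
Proof.
move=> iJ aJ a; have [iI IJ] := id_tensP E iJ aJ.
apply: htens_ext => [||x h] /=.
- exact: bounded_op_comp (isometry_bounded iI) (hr_act_bounded _ a).
- exact: bounded_op_comp (hr_act_bounded _ a) (isometry_bounded iI).
- by rewrite rt_act !IJ rt_act.
Qed.

Lemma tens_idP E F H (t : E -> F) : (forall z w, hm_ip (t z) (t w) = hm_ip z w) ->
  isometry (tens_id (T := T) (H := H) t) /\
  forall x h, tens_id (T := T) (H := H) t (htens T x h) = htens T (t x) h.
Proof. by move=> tip; apply: tens_liftP => x h y k; rewrite rt_ip tip. Qed.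

Lemma tens_total E F H : total_set (range (fun p : E * F * H =>
  htens T (E := tc_tensor T E F) (tens T p.1.1 p.1.2) p.2)).
Proof.
have := total_htens H (ct_total (tc_tensor T E F)); congr total_set.
apply/seteqP; split=> [_ [_ [x [y ->]] [h ->]]|_ [[[x y] h] _ <-]].
  by exists (x, y, h).
by exists (tens T x y); [exists x, y|exists h].
Qed.

(** Both families of triple tensors have the inner products <h, <y, <x,x'> y'> h'>. *)
Lemma assocP E F H :
  isometry (assoc (T := T) (E := E) (F := F) (H := H)) /\
  forall (x : E) (y : F) (h : H), assoc (htens T (E := tc_tensor T E F) (tens T x y) h) = htens T x (htens T y h).
Proof.
have [|L [iL Lf]] := isometry_extension
  (f := fun p : E * F * H => htens T p.1.1 (htens T p.1.2 p.2)) (@tens_total E F H).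
  by move=> [[x y] h] [[x' y'] h'] /=; rewrite !rt_ip rt_act rt_ip ct_ip.
have {}Lf x y h : L (htens T (E := tc_tensor T E F) (tens T x y) h) = htens T x (htens T y h) := Lf (x, y, h).
have [bT Tf] := the_opP (P := [set L : tc_rep T (tc_tensor T E F) H ->
   tc_rep T E (tc_rep T F H) |
   forall x y h, L (htens T (E := tc_tensor T E F) (tens T x y) h) = htens T x (htens T y h)])
   (isometry_bounded iL) Lf.
split=> //; have <- : L = @assoc R A T E F H; last by [].
apply/funext; apply: (total_eq (@tens_total E F H) (isometry_bounded iL) bT).
by move=> _ [[[x y] h] _ <-] /=; rewrite Lf; exact/esym/Tf.
Qed.

End Tensors.

(** * Isometric representations through inner products *)

Section IsometricRepresentations.
Context {R : realType} {A : cstarAlgebra R} (T : tensorCalculus A).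
Implicit Types (E F : corr A) (H K G : hrep A).

(** Stated for a bare map, so that it also covers [induced_map] and [M_Theta], which are not
    packaged as [covRep]; isometry is expressed without [adjop]. *)
Definition isorep {E H} (V : E -> H -> H) : Prop :=
  [/\ nondegenerate_rep H, forall x, bounded_op (V x),
      forall x h y k, hs_ip (V x h) (V y k) = hs_ip h (hr_act (hm_ip x y) k) &
      forall a x h, V (co_act a x) h = hr_act a (V x h)].

Lemma isometric_isorep E H (V : covRep E H) : isometric V -> isorep V.
Proof.
move=> iV; split; [exact: cr_nondegenerate V|exact: cr_bounded|
  |by move=> a x h; exact: cr_actl].
move=> x h y k; have [_ aV] := adjopP (cr_bounded V x).
by rewrite aV iV.
Qed.

Lemma isorep_isometric E H (V : E -> H -> H) : isorep V -> isometric V.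
Proof.
move=> [_ bV ipV _] x y h; have [_ aV] := adjopP (bV x).
apply: ip_ext => z; rewrite -hs_ip_conj -aV ipV -[RHS]hs_ip_conj; congr (_^*).
Qed.

(** A vector [k] orthogonal to all a k' satisfies a^# k = 0 for every a. Then [J k] is orthogonal to
    all a h, so it vanishes. *)
Lemma nondegenerate_sub H K (J : K -> H) : isometry J -> intertwines J ->
  nondegenerate_rep H -> nondegenerate_rep K.
Proof.
move=> iJ aJ /total_setP nH; apply/total_setP => k kK.
apply: (isometry_inj iJ); rewrite (bounded_op0 (isometry_bounded iJ)).
apply: nH => _ [a [h ->]]; rewrite hr_act_adj -aJ.
suff -> : hr_act a^# k = 0 by rewrite (bounded_op0 (isometry_bounded iJ)) hs_ipr0.
by apply: ip_self0; rewrite [LHS]hr_act_adjr; apply: kK; eexists; eexists.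
Qed.

End IsometricRepresentations.

(** * Iterates and the Wold decomposition *)

Section Iterates.
Context {R : realType} {A : cstarAlgebra R} (T : tensorCalculus A).
Local Notation tilden V n := (@tilde_n _ _ T _ _ V n).
Implicit Types (E F : corr A) (H K G : hrep A).

Lemma tildeP E H (V : E -> H -> H) : isorep V ->
  isometry (tilde T V) /\ forall x h, tilde T V (htens T x h) = V x h.
Proof. by move=> [_ _ ipV _]; exact: tens_liftP. Qed.

Lemma creation_ip E n (x y : E) (eta zeta : tpow T E n) :
  hm_ip (creation x eta) (creation y zeta) = hm_ip eta (co_act (hm_ip x y) zeta).
Proof.
case: n eta zeta => [|n] eta zeta; last exact: ct_ip.
by rewrite /= hm_ip_act -hm_ip_star hm_ip_act cs_starM hm_ip_star cs_mulA.
Qed.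

Lemma creation_act E n a (x : E) (eta : tpow T E n) :
  co_act a (creation x eta) = creation (co_act a x) eta.
Proof.
case: n eta => [|n] eta; last exact: ct_actl.
exact: hm_act_co_act.
Qed.

(** For n = 0 creation is the right action, and x a (x) h = x (x) a h; nondegeneracy of [H] then
    recovers all elementary tensors. *)
Lemma creation_total E H n : nondegenerate_rep H ->
  total_set (range (fun p : E * tpow T E n * H =>
    htens T (creation p.1.1 p.1.2) p.2)).
Proof.
case: n => [|n] nH; last exact: tens_total.
apply/total_setP => z zS; apply: hs_ip_total (rt_total (tc_rep T E H)) _ => _ [x [h ->]].
apply: (total_eq nH (f := fun h => hs_ip z (htens T x h) : R[i]^o)
  (g := fun=> 0)).
- exact: (bounded_op_comp (hs_ip_bounded z) (htens_boundedr T H x)).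
- exact: bounded_op_cst0.
- move=> _ [a [k ->]]; apply/ip_orth_sym/zS; exists (x, a, k) => //=.
  exact: rt_balanced.
Qed.

Lemma creation_ext E H n (Y : normedModType R[i])
    (f g : tc_rep T (tpow T E n.+1) H -> Y) :
  nondegenerate_rep H -> bounded_op f -> bounded_op g ->
  (forall x (eta : tpow T E n) h,
    f (htens T (creation x eta) h) = g (htens T (creation x eta) h)) -> f =1 g.
Proof.
move=> nH bf bg fg; apply: (total_eq (@creation_total E H n nH) bf bg).
by move=> _ [[[x eta] h] _ <-]; exact: fg.
Qed.

Lemma htens_orth E H K (L : tc_rep T E H -> K) k :
  bounded_op L -> (forall x h, hs_ip k (L (htens T x h)) = 0) ->
  forall z, hs_ip k (L z) = 0.
Proof.
move=> bL kL; apply: (htens_ext (f := fun z => hs_ip k (L z) : R[i]^o) (g := fun=> 0)) => //.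
  exact: (bounded_op_comp (hs_ip_bounded k) bL).
exact: bounded_op_cst0.
Qed.

Lemma creation_orth E H K n (L : tc_rep T (tpow T E n.+1) H -> K) k :
  nondegenerate_rep H -> bounded_op L ->
  (forall x (eta : tpow T E n) h, hs_ip k (L (htens T (creation x eta) h)) = 0) ->
  forall z, hs_ip k (L z) = 0.
Proof.
move=> nH bL kL.
apply: (creation_ext nH (f := fun z => hs_ip k (L z) : R[i]^o) (g := fun=> 0)) => //.
  exact: (bounded_op_comp (hs_ip_bounded k) bL).
exact: bounded_op_cst0.
Qed.

Lemma tilde_n0P E H (V : E -> H -> H) :
  isometry (tilden V 0) /\
  forall (a : id_corr A) h, tilden V 0 (htens T (E := tpow T E 0) a h) = hr_act (a : A) h.
Proof.
by apply: tens_liftP => a h b k; rewrite hr_act_adj -hr_actM.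
Qed.

(** The Gram computation at level n+1 produces <x,y> acting after the n-th iterate; the intertwining
    property moves it inside before isometry is used. *)
Lemma tilde_nSP E H (V : E -> H -> H) n : isorep V ->
  isometry (tilden V n) -> intertwines (tilden V n) ->
  isometry (tilden V n.+1) /\
  forall x (eta : tpow T E n) h,
    tilden V n.+1 (htens T (creation x eta) h) = V x (tilden V n (htens T eta h)).
Proof.
move=> [nH bV ipV aV] iV eV.
have [|L [iL Lf]] := isometry_extension
  (f := fun p : E * tpow T E n * H => V p.1.1 (tilden V n (htens T p.1.2 p.2)))
  (@creation_total E H n nH).
  move=> [[x eta] h] [[y zeta] k] /=; rewrite ipV -eV (isometry_ip _ _ iV).
  by rewrite rt_act !rt_ip creation_ip.
have {}Lf x (eta : tpow T E n) h : L (htens T (creation x eta) h) =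
  V x (tilden V n (htens T eta h)) := Lf (x, eta, h).
have [bT Tf] := the_opP (P := [set L : tc_rep T (tpow T E n.+1) H -> H |
  forall x (eta : tpow T E n) h, L (htens T (creation x eta) h) =
    V x (tilden V n (htens T eta h))]) (isometry_bounded iL) Lf.
split=> //; have <- : L = @tilde_n R A T E H V n.+1; last by [].
apply/funext/(creation_ext nH) => //; first exact: isometry_bounded.
by move=> x eta h; rewrite Lf; exact/esym/Tf.
Qed.

Lemma tilde_n_isometry_intertwines E H (V : E -> H -> H) n : isorep V ->
  isometry (tilden V n) /\ intertwines (tilden V n).
Proof.
move=> rV; have [nH bV ipV aV] := rV; elim: n => [|n [iV eV]].
  have [iV V0] := tilde_n0P V; split=> // a; apply: htens_ext.
  - exact: bounded_op_comp (isometry_bounded iV) (hr_act_bounded _ a).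
  - exact: bounded_op_comp (hr_act_bounded _ a) (isometry_bounded iV).
  - by move=> b h; rewrite rt_act !V0 -hr_actM.
have [iS VS] := tilde_nSP rV iV eV; split=> // a; apply: (creation_ext nH).
- exact: bounded_op_comp (isometry_bounded iS) (hr_act_bounded _ a).
- exact: bounded_op_comp (hr_act_bounded _ a) (isometry_bounded iS).
- by move=> x eta h; rewrite rt_act creation_act !VS aV.
Qed.

Lemma tilde_n_isometry E H (V : E -> H -> H) n : isorep V ->
  isometry (tilden V n).
Proof. by move=> /(tilde_n_isometry_intertwines n) []. Qed.

Lemma tilde_n_act E H (V : E -> H -> H) n : isorep V ->
  intertwines (tilden V n).
Proof. by move=> /(tilde_n_isometry_intertwines n) []. Qed.

Lemma tilde_nS E H (V : E -> H -> H) n x (eta : tpow T E n) h : isorep V ->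
  tilden V n.+1 (htens T (creation x eta) h) = V x (tilden V n (htens T eta h)).
Proof.
move=> rV.
exact: (tilde_nSP rV (tilde_n_isometry n rV) (tilde_n_act (n := n) rV)).2.
Qed.

Lemma V_n0 E H (V : E -> H -> H) (a : tpow T E 0) (h : H) :
  V_n V a h = hr_act (a : A) h.
Proof. exact: (tilde_n0P V).2. Qed.

Lemma V_nS E H (V : E -> H -> H) n x (eta : tpow T E n) (h : H) : isorep V ->
  V_n V (creation x eta) h = V x (V_n V eta h).
Proof. exact: tilde_nS. Qed.

Lemma V_n_act E H (V : E -> H -> H) n a (eta : tpow T E n) (h : H) : isorep V ->
  hr_act a (V_n V eta h) = V_n V (co_act a eta) h.
Proof. by move=> rV; rewrite /V_n -(tilde_n_act (n := n) rV) rt_act. Qed.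

Lemma tilde_n_intertwine E K G (V : E -> K -> K) (V' : E -> G -> G) (J : K -> G) n z :
  isorep V -> isorep V' -> isometry J -> intertwines J ->
  (forall x k, J (V x k) = V' x (J k)) ->
  J (tilden V n z) = tilden V' n (id_tens T (tpow T E n) J z).
Proof.
move=> rV rV' iJ aJ JV; have bJ := isometry_bounded iJ.
elim: n z => [|n IH].
  have [iV V0] := tilde_n0P V; have [iV' V'0] := tilde_n0P V'.
  have [iI IJ] := id_tensP T (tpow T E 0) iJ aJ.
  apply: htens_ext => [||a h].
  - exact: (bounded_op_comp bJ (isometry_bounded iV)).
  - exact: (bounded_op_comp (isometry_bounded iV') (isometry_bounded iI)).
  - by rewrite V0 IJ V'0 aJ.
have [nK _ _ _] := rV.
have [iI IJ] := id_tensP T (tpow T E n.+1) iJ aJ.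
have [_ IJn] := id_tensP T (tpow T E n) iJ aJ.
apply: (creation_ext nK) => [||x eta h].
- exact: (bounded_op_comp bJ (isometry_bounded (tilde_n_isometry n.+1 rV))).
- exact: (bounded_op_comp (isometry_bounded (tilde_n_isometry n.+1 rV')) (isometry_bounded iI)).
- by rewrite IJ !tilde_nS// JV IH IJn.
Qed.

End Iterates.

(** * Orthogonality and totality of the iterates of the wandering subspace *)

Section Wold.
Context {R : realType} {A : cstarAlgebra R} (T : tensorCalculus A).
Local Notation tilden V n := (@tilde_n _ _ T _ _ V n).
Context {E : corr A} {H : hrep A} (V : covRep E H).
Hypothesis rV : isorep V.
Let W : hrep A := wandering T V.

Lemma wval_isometry : isometry (@wval R A T E H V).
Proof. by apply: isometry_of_ip. Qed.

Lemma wval_act : intertwines (@wval R A T E H V).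
Proof. by []. Qed.

Lemma wandering_nondegenerate : nondegenerate_rep W.
Proof.
by have [nH _ _ _] := rV; exact: nondegenerate_sub wval_isometry wval_act nH.
Qed.

Lemma wvalP (w : W) x h : hs_ip (wval w) (V x h) = 0.
Proof.
have [_ VE] := tildeP T rV; rewrite -VE.
exact: (set_mem (valP (w : subsp (wandering_closed T V)))).
Qed.

Lemma wval_onto h : (forall x k, hs_ip h (V x k) = 0) -> exists w : W, wval w = h.
Proof.
move=> hV; have hW : wandering_set T V h.
  have [iV VE] := tildeP T rV.
  by apply: htens_orth (isometry_bounded iV) _ => x k; rewrite VE hV.
by exists (exist _ h (mem_set hW)).
Qed.

Let D n (z : tc_rep T (tpow T E n) W) : H :=
  tilden V n (id_tens T (tpow T E n) (@wval R A T E H V) z).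

Let idP n := id_tensP T (tpow T E n) wval_isometry wval_act.

Let D_isometry n : isometry (@D n).
Proof. exact (isometry_comp (tilde_n_isometry T n rV) (idP n).1). Qed.

Let D_V_n n (eta : tpow T E n) (w : W) : D (htens T eta w) = V_n V eta (wval w).
Proof. by rewrite /D (idP n).2. Qed.

(** Isometry of [V] strips one factor from each side, until one vector lies in the wandering
    subspace and the other in the closed span of the ranges of the V x. *)
Let D_orth m n z z' : (m < n)%N -> hs_ip (@D m z) (@D n z') = 0.
Proof.
have bD k := isometry_bounded (D_isometry k).
have nW := wandering_nondegenerate.
elim: m n z z' => [|m IH] [|n] // z z' mn; apply/ip_orth_sym; move: z.
  apply: htens_orth (bD _) _ => a w.
  apply/ip_orth_sym; move: z'; apply: (creation_orth nW (bD _)) => x eta w'.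
  by rewrite !D_V_n V_n0 V_nS// -wval_act wvalP.
apply: (creation_orth nW (bD _)) => x eta w.
apply/ip_orth_sym; move: z'; apply: (creation_orth nW (bD _)) => y zeta w'.
have [_ _ ipV _] := rV.
by rewrite !D_V_n !V_nS// ipV V_n_act// -!D_V_n IH.
Qed.

Lemma V_n_orth m n (eta : tpow T E m) (zeta : tpow T E n) (w w' : W) : m != n ->
  hs_ip (V_n V eta (wval w)) (V_n V zeta (wval w')) = 0.
Proof.
rewrite -!D_V_n neq_ltn => /orP [mn|nm]; first exact: D_orth.
by apply: ip_orth_sym; exact: D_orth.
Qed.

Lemma V_n_ip n (eta zeta : tpow T E n) (w w' : W) :
  hs_ip (V_n V eta (wval w)) (V_n V zeta (wval w')) = hs_ip w (hr_act (hm_ip eta zeta) w').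
Proof. by rewrite -!D_V_n (isometry_ip _ _ (D_isometry n)) rt_ip. Qed.

Let idx : Type := {n : nat & (tpow T E n * W)%type}.

(* With N the closed span of the family, N^perp is contained in the closed    *)
(* span of the V x k, k in N^perp, hence in the range of every iterate, and   *)
(* purity makes it vanish.                                                    *)
Lemma wandering_total : pure T V -> total_set
  (range (fun p : idx => V_n V (projT2 p).1 (wval (projT2 p).2))).
Proof.
move=> pV; set S := range _.
have [nH bV ipV aV] := rV.
have nW := wandering_nondegenerate.
pose N := closure (linspan S).
have cN : closed_subspace N := closed_subspace_linspan S.
have SN y : S y -> N y by move=> Sy; apply: subset_closure; exact: mem_linspan.
pose P := [set h : H | forall y, N y -> hs_ip y h = 0].
have cP : closed_subspace P := closed_subspace_orth N.
have NV x h : N h -> N (V x h).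
  apply: (sub_closure_linspan (closed_subspace_preimage (bV x) cN)) => {h}.
  move=> _ [[n [eta w]] _ <-] /=; rewrite -V_nS//; apply: SN.
  by exists (existT _ n.+1 (creation x eta, w)).
have Na a h : N h -> N (hr_act a h).
  apply: (sub_closure_linspan (closed_subspace_preimage (hr_act_bounded _ a) cN)) => {h}.
  move=> _ [[n [eta w]] _ <-] /=; rewrite V_n_act//; apply: SN.
  by exists (existT _ n (co_act a eta, w)).
have Pa a h : P h -> P (hr_act a h).
  by move=> Ph y Ny; rewrite hr_act_adjr; apply/Ph/Na.
have [itV VE] := tildeP T rV.
(* [P] is orthogonal to the wandering subspace, so [h] is some tilde V z. As each V x preserves [N],
   [z] is orthogonal to all x (x) n with n in [N], hence lies in the closed span of the x (x) k with
   k in [P]. *)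
have Ptilde h : P h -> exists2 z, tilde T V z = h &
    closure (linspan [set z | exists x k, P k /\ z = htens T x k]) z.
  move=> Ph; set C := closure _.
  have [z _ zh] : range (tilde T V) h.
    apply: orthogonal_closure (isometry_range_closed itV) _ => y yV.
    have [|w <-] := @wval_onto y.
      by move=> x k; apply/ip_orth_sym/yV; exists (htens T x k).
    apply/ip_orth_sym; move: w.
    apply: (total_eq nW (f := fun w : W => hs_ip h (wval w) : R[i]^o) (g := fun=> 0)).
    - exact: (bounded_op_comp (hs_ip_bounded h) (isometry_bounded wval_isometry)).
    - exact: bounded_op_cst0.
    (* Degree 0 only contributes vectors a w, as [A] may lack a unit; nondegeneracy of [W] makes
       these total. *)
    - move=> _ [a [w ->]]; apply/ip_orth_sym/Ph/SN.
      by exists (existT _ 0%N (a, w)) => //=; rewrite V_n0 wval_act.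
  exists z => //.
  have cC : closed_subspace C by exact: closed_subspace_linspan.
  have [c Cc zc] := projection z cC.
  suff /eqP : z - c = 0 by rewrite subr_eq0 => /eqP ->.
  have orthN x n : N n -> hs_ip (htens T x n) (z - c) = 0.
    move=> Nn; rewrite ipBr.
    have -> : hs_ip (htens T x n) z = 0.
      by rewrite -(isometry_ip _ _ itV) VE zh; apply/Ph/NV.
    have cO := closed_subspace_orth [set htens T x n].
    rewrite (sub_closure_linspan cO _ Cc) ?subrr// => _ [y [k [Pk ->]]] _ -> /=.
    by rewrite rt_ip; apply: Pa.
  apply: hs_ip_total (rt_total (tc_rep T E H)) _ => _ [x [h' ->]].
  have [n Nn nP] := projection h' cN.
  rewrite -[h'](subrK n); have bx := htens_boundedr T H x.
  rewrite -/(htens T x _) (bounded_opD _ _ bx) ipDr.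
  rewrite (ip_orth_sym (orthN _ _ Nn)) addr0; apply/ip_orth_sym/zc.
  apply: subset_closure; apply: mem_linspan; exists x, (h' - n); split=> //.
have Prange n h : P h -> range (tilden V n) h.
  elim: n h => [|n IH] h.
    move=> _; apply: isometry_onto_total (tilde_n_isometry T 0 rV) nH _ _.
    by move=> _ [a [k ->]]; exists (htens T (E := tpow T E 0) a k) => //; exact: V_n0.
  have cS := isometry_range_closed (tilde_n_isometry T n.+1 rV).
  move=> /Ptilde [z <- Cz].
  apply: (sub_closure_linspan (closed_subspace_preimage (isometry_bounded itV) cS) _ Cz).
  move=> _ [x [k [/IH [z' _ <-] ->]]] /=; rewrite VE.
  have : closure (linspan (range (fun p : tpow T E n * H => htens T p.1 p.2))) z'.
    by rewrite htens_total.
  have bc := bounded_op_comp (bV x) (isometry_bounded (tilde_n_isometry T n rV)).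
  apply: (sub_closure_linspan (closed_subspace_preimage bc cS)).
  by move=> _ [[eta k'] _ <-] /=; exists (htens T (creation x eta) k') => //; exact: V_nS.
apply/total_setP => h hS.
have Ph : P h.
  move=> y Ny; have cO := closed_subspace_orth [set h].
  apply/ip_orth_sym/(sub_closure_linspan cO _ Ny) => // y' Sy' _ -> /=.
  exact/ip_orth_sym/hS.
have := pV h.
have -> : (fun n => tilden V n (adjop (tilden V n) h)) = (fun=> h).
  apply/funext => n; have [z _ <-] := Prange n h Ph.
  by rewrite isometry_adjK//; exact: tilde_n_isometry.
move=> h0; apply: (@cvg_unique _ _ _ _ _ _ (cvg_cst h) h0).
exact: norm_hausdorff.
Qed.

End Wold.

Lemma the_op_dichotomy (R : realType) (X Y : normedModType R[i]) (P : set (X -> Y)) :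
  P (the_op P) \/ the_op P = (fun=> 0).
Proof. by rewrite /the_op; case: xgetP => [f _ []|]; [left|right]. Qed.

(** * Conjugation by the Wold unitary *)

Section Conjugation.
Context {R : realType} {A : cstarAlgebra R}.
Context {H G : hrep A} (U : H -> G).
Hypotheses (iU : isometry U) (aU : intertwines U) (onU : forall g, range U g).

Lemma unitary_adjK : cancel (adjop U) U.
Proof. by move=> g; have [h _ <-] := onU g; rewrite isometry_adjK. Qed.

Lemma unitary_adj_isometry : isometry (adjop U).
Proof.
by apply: isometry_of_ip => x y; rewrite -(isometry_ip _ _ iU) !unitary_adjK.
Qed.

Lemma unitary_adj_act : intertwines (adjop U).
Proof. by move=> a g; apply: (isometry_inj iU); rewrite aU !unitary_adjK. Qed.

Lemma isorep_conj (F : corr A) (V : F -> H -> H) :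
  isorep V -> isorep (fun x => U \o V x \o adjop U).
Proof.
move=> [nH bV ipV aV]; split=> [||x h y k|a x h] /=.
- exact: nondegenerate_sub unitary_adj_isometry unitary_adj_act nH.
- move=> x; apply: bounded_op_comp (isometry_bounded unitary_adj_isometry).
  exact: bounded_op_comp (isometry_bounded iU) (bV x).
- rewrite (isometry_ip _ _ iU) ipV -unitary_adj_act.
  exact: (isometry_ip _ _ unitary_adj_isometry).
- by rewrite aV aU.
Qed.

End Conjugation.

Section WoldDecomposition.
Context {R : realType} {A : cstarAlgebra R} (T : tensorCalculus A).
Context {E : corr A} {H : hrep A} (V : covRep E H).
Hypotheses (rV : isorep V) (pV : pure T V).
Let W : hrep A := wandering T V.
Let G : hrep A := tc_rep T (fock T E) W.

Let G_total : total_set (range (fun p : {n : nat & (tpow T E n * W)%type} =>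
  htens T (fock_inj (projT2 p).1) (projT2 p).2)).
Proof.
have := total_htens T W (sm_total (tc_sum T (tpow T E))); congr total_set.
apply/seteqP; split=> [_ [_ [n [eta ->]] [w ->]]|_ [[n [eta w]] _ <-]].
  by exists (existT _ n (eta, w)).
by exists (fock_inj eta); [exists n, eta|exists w].
Qed.

(** The vectors V_n(eta) w are total and have the Gram matrix of the Fock space tensors: [V_n_ip] in
    equal degrees, 0 in different ones. *)
Lemma woldP : isometry (wold T V) /\
  forall n (eta : tpow T E n) (w : W),
    wold T V (V_n V eta (wval w)) = htens T (fock_inj eta) w.
Proof.
have tV := wandering_total rV pV.
have [|L [iL Lf]] := isometry_extension
  (f := fun p : {n : nat & (tpow T E n * W)%type} =>
    htens T (fock_inj (projT2 p).1) (projT2 p).2 : G) tV.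
  move=> [m [eta w]] [n [zeta w']] /=; rewrite rt_ip.
  have [mn|mn] := eqVneq m n.
    by case: n / mn zeta => zeta; rewrite V_n_ip// sm_inj_ip.
  by rewrite V_n_orth// sm_inj_orth// hr_act0l hs_ipr0.
have {}Lf n (eta : tpow T E n) w : L (V_n V eta (wval w)) = htens T (fock_inj eta) w
  := Lf (existT _ n (eta, w)).
have [bT Tf] := the_opP (P := [set L : H -> G | forall n (eta : tpow T E n) (w : W),
  L (V_n V eta (wval w)) = htens T (fock_inj eta) w]) (isometry_bounded iL) Lf.
split=> //; have <- : L = wold T V; last by [].
apply/funext; apply: (total_eq tV (isometry_bounded iL) bT).
by move=> _ [[n [eta w]] _ <-] /=; rewrite Lf; exact/esym/Tf.
Qed.

Lemma wold_isometry : isometry (wold T V). Proof. exact: woldP.1. Qed.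

Lemma woldE n (eta : tpow T E n) (w : W) :
  wold T V (V_n V eta (wval w)) = htens T (fock_inj eta) w.
Proof. exact: woldP.2. Qed.

Lemma wold_onto g : range (wold T V) g.
Proof.
apply: isometry_onto_total wold_isometry G_total _ g.
by move=> _ [[n [eta w]] _ <-] /=; exists (V_n V eta (wval w)) => //; exact: woldE.
Qed.

Lemma wold_act : intertwines (wold T V).
Proof.
have bU := isometry_bounded wold_isometry.
move=> a; apply: (total_eq (wandering_total rV pV)).
- exact: bounded_op_comp bU (hr_act_bounded _ a).
- exact: bounded_op_comp (hr_act_bounded _ a) bU.
- move=> _ [[n [eta w]] _ <-] /=.
  by rewrite V_n_act// !woldE rt_act sm_inj_actl.
Qed.

Lemma M_Theta_isorep (F : corr A) (V' : F -> H -> H) : isorep V' -> isorep (M_Theta T V V').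
Proof. exact: (isorep_conj wold_isometry wold_act wold_onto). Qed.

(** Puts [S] in the same form as [M_Theta], so that both indices can be treated uniformly. *)
Lemma induced_mapE : induced_map T E W = M_Theta T V V.
Proof.
have [_ bS _ _] := M_Theta_isorep rV.
apply/funext => x; apply/funext.
have Sf n (eta : tpow T E n) (w : W) :
    M_Theta T V V x (htens T (fock_inj eta) w) = htens T (fock_inj (creation x eta)) w.
  by rewrite /M_Theta /= -!woldE isometry_adjK ?V_nS//; exact: wold_isometry.
have [bT Tf] := the_opP (P := [set L : G -> G | forall n (eta : tpow T E n) k,
  L (htens T (fock_inj eta) k) = htens T (fock_inj (creation x eta)) k]) (bS x) Sf.
apply: (total_eq G_total bT (bS x)) => _ [[n [eta w]] _ <-] /=.
by rewrite Sf; exact: Tf.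
Qed.

End WoldDecomposition.

Section TildeTilde.
Context {R : realType} {A : cstarAlgebra R} (T : tensorCalculus A).

Lemma tilde_intertwines (E : corr A) (H : hrep A) (V : E -> H -> H) :
  isorep V -> intertwines (tilde T V).
Proof.
move=> rV a; have [iV VE] := tildeP T rV; have [_ _ _ aV] := rV.
apply: htens_ext => [||x h].
- exact: (bounded_op_comp (isometry_bounded iV) (hr_act_bounded _ a)).
- exact: (bounded_op_comp (hr_act_bounded _ a) (isometry_bounded iV)).
- by rewrite rt_act !VE aV.
Qed.

(** Either side of the commutation relation has this shape; knowing it to be an isometry, identities
    may be tested on elementary tensors. *)
Lemma tilde_tildeP (E F : corr A) (H : hrep A) (V : E -> H -> H) (W : F -> H -> H) :
  isorep V -> isorep W ->
  isometry (fun z => tilde T V (id_tens T E (tilde T W) (assoc z))) /\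
  forall x y h, tilde T V (id_tens T E (tilde T W)
    (assoc (htens T (E := tc_tensor T E F) (tens T x y) h))) = V x (W y h).
Proof.
move=> rV rW; have [iV VE] := tildeP T rV; have [iW WE] := tildeP T rW.
have [iI IE] := id_tensP T E iW (tilde_intertwines rW).
have [ia aE] := assocP T E F H.
split=> [|x y h]; last by rewrite aE IE VE WE.
exact: (isometry_comp (isometry_comp iV iI) ia).
Qed.

End TildeTilde.

(** * Restriction along an isometry *)

Section Restriction.
Context {R : realType} {A : cstarAlgebra R} (T : tensorCalculus A).
Local Notation tilden V n := (@tilde_n _ _ T _ _ V n).
Context {H K : hrep A} (J : K -> H).
Hypotheses (iJ : isometry J) (aJ : intertwines J).
Let bJ := isometry_bounded iJ.

Lemma adjop_range h : range J h -> J (adjop J h) = h.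
Proof. by move=> [k _ <-]; rewrite isometry_adjK. Qed.

Lemma isorep_restrict (E : corr A) (V : E -> H -> H) (V' : E -> K -> K) :
  (forall x k, J (V' x k) = V x (J k)) -> isorep V ->
  (forall x, bounded_op (V' x)) -> isorep V'.
Proof.
move=> JV [nH bV ipV aV] bV'; split=> // [|x h y k|a x h].
- exact: nondegenerate_sub iJ aJ nH.
- by rewrite -(isometry_ip _ _ iJ) !JV ipV -aJ (isometry_ip _ _ iJ).
- by apply: (isometry_inj iJ); rewrite aJ !JV aV.
Qed.

(** Take V' = J^* V J. Invariance of the range gives J V' = V J, and since [J] preserves norms and
    is injective, every axiom, including the matrix estimate, descends. *)
Lemma covRep_restrict (E : corr A) (V : covRep E H) : isorep V ->
  (forall x k, range J (V x (J k))) ->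
  exists V' : covRep E K, forall x k, J (V' x k) = V x (J k).
Proof.
move=> rV VJ; have [nH bV ipV aV] := rV.
pose V' x := adjop J \o V x \o J.
have JV x k : J (V' x k) = V x (J k) := adjop_range (VJ x k).
have bV' x : bounded_op (V' x).
  exact: bounded_op_comp (bounded_op_comp (adjopP bJ).1 (bV x)) bJ.
have lV' k : linear (V' ^~ k).
  move=> c x y; apply: (isometry_inj iJ).
  by rewrite bJ.1 !JV; exact: cr_linear.
have cbV' : completely_bounded V'.
  have [c c0 cP] := cr_cb V; exists c => // n X r r0 Xr h.
  rewrite (eq_bigr (fun k => `|\sum_l V (X k l) (J (h l))| ^+ 2)); last first.
    move=> k _; rewrite -iJ.2 (bounded_op_sum _ bJ).
    by congr (`|_| ^+ 2); apply: eq_bigr => l _; rewrite JV.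
  rewrite [X in _ <= _ * X](eq_bigr (fun l => `|J (h l)| ^+ 2)).
    exact: cP.
  by move=> l _; rewrite iJ.2.
have cV' b x a h : V' (co_act b (hm_act x a)) h = hr_act b (V' x (hr_act a h)).
  by apply: (isometry_inj iJ); rewrite aJ !JV aJ; exact: cr_covariant.
by exists (CovRep (nondegenerate_sub iJ aJ nH) bV' lV' cbV' cV').
Qed.

(** For p = P'_n k and q = P_n J k, the vector J p lies in the range of the n-th iterate of [V], so
    |p|^2 = <p, k> = <J p, J k> = <J p, q> <= |p| |q|. *)
Lemma pure_restrict (E : corr A) (V : E -> H -> H) (V' : E -> K -> K) :
  isorep V -> isorep V' -> (forall x k, J (V' x k) = V x (J k)) ->
  pure T V -> pure T V'.
Proof.
move=> rV rV' JV pV k.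
apply/(@cvg_nmP R K nat) => e e0.
have /(@cvg_nmP R H nat) /(_ e e0) := pV (J k).
apply: filterS => n; rewrite !sub0r !nmN; apply: le_lt_trans.
have iV := tilde_n_isometry T n rV; have iV' := tilde_n_isometry T n rV'.
set p := tilden V' n _; set q := tilden V n _.
have [->|p0] := eqVneq p 0; first by rewrite nm0 nm_ge0.
have pp : 0 < nm p.
  by rewrite lt_neqAle nm_ge0 andbT; apply: contra_neq p0 => /esym/nm_eq0.
rewrite -(ler_pM2r pp) -expr2 nm_ip [leRHS]mulrC -(isometry_nm p iJ).
apply: le_trans (re_CS _ _); rewrite le_eqVlt; apply/orP; left; apply/eqP.
congr complex.Re.
have [_ aV] := adjopP (isometry_bounded iV).
have [_ aV'] := adjopP (isometry_bounded iV').
transitivity (hs_ip p k).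
  by rewrite {2}/p -/(tilden V' n _) [LHS]aV' isometry_adjK// -aV'.
have Jp : J p = tilden V n (id_tens T _ J (adjop (tilden V' n) k)).
  exact: tilde_n_intertwine rV' rV iJ aJ JV.
by rewrite -(isometry_ip _ _ iJ) Jp /q (isometry_ip _ _ iV) aV.
Qed.

(** [JPhi] carries both sides of the commutation relation to [H], where it holds; t (x) I commutes
    with I (x) J, and [J] is injective. *)
Lemma psRep_restrict (P : productSystem T) (V : psRep P H) :
  (forall k, isometric (V k)) ->
  (forall k x m, range J (V k x (J m))) ->
  exists V' : psRep P K, forall k x m, J (V' k x m) = V k x (J m).
Proof.
move=> isoV VJ; have rV k := isometric_isorep (isoV k).
have exV' k : exists V' : covRep (P k) K, forall x m, J (V' x m) = V k x (J m).
  exact: covRep_restrict (rV k) (VJ k).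
pose V' k := sval (cid (exV' k)).
have JV' k x m : J (V' k x m) = V k x (J m) := svalP (cid (exV' k)) x m.
have rV' k : isorep (V' k).
  by apply: isorep_restrict (JV' k) (rV k) _ => x; exact: cr_bounded.
have JPhi k l z : J (tilde T (V' k) (id_tens T (P k) (tilde T (V' l)) (assoc z))) =
    tilde T (V k) (id_tens T (P k) (tilde T (V l))
      (assoc (id_tens T (tc_tensor T (P k) (P l)) J z))).
  have [iI IJ] := id_tensP T (tc_tensor T (P k) (P l)) iJ aJ.
  have [iK KE] := tilde_tildeP T (rV' k) (rV' l).
  have [iH HE] := tilde_tildeP T (rV k) (rV l).
  move: z; apply: (total_eq (@tens_total R A T (P k) (P l) K)).
  - exact: (bounded_op_comp bJ (isometry_bounded iK)).
  - exact: (bounded_op_comp (isometry_bounded iH) (isometry_bounded iI)).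
  - by move=> _ [[[x y] h] _ <-] /=; rewrite KE IJ HE !JV'.
have t12_ip z w : hm_ip (@ps_t12 R A T P z) (ps_t12 w) = hm_ip z w.
  by rewrite -ps_t21_ip !ps_t12K.
have comm z : tilde T (V' ord0) (id_tens T _ (tilde T (V' ord_max)) (assoc z)) =
    tilde T (V' ord_max) (id_tens T _ (tilde T (V' ord0))
      (assoc (tens_id (T := T) (@ps_t12 R A T P) z))).
  apply: (isometry_inj iJ); rewrite !JPhi (pr_comm V).
  congr (tilde T _ (id_tens T _ _ (assoc _))).
  have [iI IJ] := id_tensP T (tc_tensor T (P ord0) (P ord_max)) iJ aJ.
  have [iI' IJ'] := id_tensP T (tc_tensor T (P ord_max) (P ord0)) iJ aJ.
  have [itK tK] := tens_idP T K t12_ip.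
  have [itH tH] := tens_idP T H t12_ip.
  move: z; apply: htens_ext => [||x h].
  - exact: (bounded_op_comp (isometry_bounded itH) (isometry_bounded iI)).
  - exact: (bounded_op_comp (isometry_bounded iI') (isometry_bounded itK)).
  - by rewrite IJ tK tH IJ'.
by exists (PsRep comm).
Qed.

End Restriction.

(** * Operators determined on the wandering subspace *)

Section MultiAnalytic.
Context {R : realType} {A : cstarAlgebra R} (T : tensorCalculus A).
Context {E F : corr A} {K G : hrep A} (V : covRep E K) (W : covRep F K).
Variables (S : E -> G -> G) (Z : F -> G -> G) (Psi : wandering T V -> G).
Hypotheses (rV : isorep V) (pV : pure T V) (rW : isorep W).
Hypotheses (rS : isorep S) (rZ : isorep Z).

(* If no operator has the property defining M_op, M_op is the junk value 0,   *)
(* which is trivially multi-analytic.                                         *)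
Lemma M_op_multi_analytic : inner T S Psi ->
  M_op T S Psi \o tilde T W = tilde T Z \o id_tens T F (M_op T S Psi) ->
  multi_analytic V W S Z (M_op T S Psi).
Proof.
move=> [bPsi aPsi iM]; have bM := isometry_bounded iM.
have tV := wandering_total rV pV.
have [_ bV _ _] := rV; have [_ bS _ aS] := rS; have [_ bZ _ _] := rZ.
have [ME|M0] := the_op_dichotomy [set L : K -> G |
    forall n (eta : tpow T E n) (h : wandering T V),
      L (V_n V eta (wval h)) = V_n S eta (Psi h)]; last first.
  rewrite /M_op M0 => _; split=> [|a k|x k|y k]; first exact: bounded_op_cst0.
  - by rewrite (bounded_op0 (hr_act_bounded G a)).
  - by rewrite (bounded_op0 (bS x)).
  - by rewrite (bounded_op0 (bZ y)).
rewrite -/(M_op T S Psi) in ME.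
have aM : intertwines (M_op T S Psi).
  move=> a; apply: (total_eq tV).
  - exact: bounded_op_comp bM (hr_act_bounded _ a).
  - exact: bounded_op_comp (hr_act_bounded _ a) bM.
  - by move=> _ [[n [eta w]] _ <-] /=; rewrite V_n_act// !ME V_n_act.
move=> MW; split=> // [x|y k].
  apply: (total_eq tV).
  - exact: bounded_op_comp bM (bV x).
  - exact: bounded_op_comp (bS x) bM.
  - by move=> _ [[n [eta w]] _ <-] /=; rewrite -V_nS// !ME V_nS.
(* Evaluating the assumed identity at y (x) k gives intertwining over [F]; the tensor formula for
   M_Psi relies on [aM]. *)
have [_ WE] := tildeP T rW; have [_ ZE] := tildeP T rZ.
have [_ IM] := id_tensP T F iM aM.
by have /= := congr1 (fun f => f (htens T y k)) MW; rewrite WE IM ZE.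
Qed.

End MultiAnalytic.

Section Inclusion.
Context {R : realType} {A : cstarAlgebra R} (T : tensorCalculus A).

Lemma multi_analytic_range_invariant (E F : corr A) (K G : hrep A)
    (V : E -> K -> K) (W : F -> K -> K) (V' : E -> G -> G) (W' : F -> G -> G)
    (L : K -> G) (M : set G) :
  closed_subspace M -> M <> [set 0] -> M = range L ->
  multi_analytic V W V' W' L -> invariant_subspace V' W' M.
Proof.
move=> cM M0 ME [_ aL VL WL]; split=> //; rewrite ME.
- by move=> a _ [k _ <-]; exists (hr_act a k).
- by move=> x _ [k _ <-]; exists (V x k).
- by move=> y _ [k _ <-]; exists (W y k).
Qed.

(** An intertwining isometry satisfies J V_n(eta) w = S_n(eta) J w, the equation defining M_Psi for
    its restriction to the wandering subspace; totality gives uniqueness. *)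
Lemma M_op_intertwiner (E : corr A) (K G : hrep A) (V : covRep E K)
    (S : E -> G -> G) (J : K -> G) :
  isorep V -> pure T V -> isorep S -> isometry J -> intertwines J ->
  (forall x k, J (V x k) = S x (J k)) ->
  M_op T S (J \o @wval R A T E K V) = J.
Proof.
move=> rV pV rS iJ aJ JV; have bJ := isometry_bounded iJ.
have JE n (eta : tpow T E n) (h : wandering T V) :
    J (V_n V eta (wval h)) = V_n S eta (J (wval h)).
  rewrite /V_n (tilde_n_intertwine _ rV rS iJ aJ JV).
  by rewrite (id_tensP T _ iJ aJ).2.
have [bM ME] := the_opP (P := [set L : K -> G |
  forall n (eta : tpow T E n) (h : wandering T V),
  L (V_n V eta (wval h)) = V_n S eta ((J \o @wval R A T E K V) h)]) bJ JE.
apply/funext; apply: (total_eq (wandering_total rV pV) bM bJ).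
by move=> _ [[n [eta w]] _ <-] /=; rewrite JE; exact: ME.
Qed.

End Inclusion.

(** * Invariant subspaces and inner operators *)

Unset Implicit Arguments.

Theorem theorem3p5 (R : realType) (A : cstarAlgebra R) (T : tensorCalculus A)
    (P : productSystem T) (H : hrep A) (V : psRep P H)
    (isoV : forall k, isometric (V k))
    (i j : 'I_2) (neq_ji : j != i) (pureV : pure T (V i))
    (M : set (tc_rep T (fock T (P i)) (wandering T (V i))))
    (clM : closed_subspace M) (M_neq0 : M <> [set 0]) :
  let G : hrep A := tc_rep T (fock T (P i)) (wandering T (V i)) in
  let S : P i -> G -> G := induced_map T (P i) (wandering T (V i)) in
  let MTheta : P j -> G -> G := M_Theta T (V i) (V j) in
  (invariant_subspace S MTheta M <->
   exists (K : hrep A) (V' : psRep P K) (Psi : wandering T (V' i) -> G),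
     [/\ forall k, isometric (V' k), pure T (V' i), inner T S Psi,
         M_op T S Psi \o tilde T (V' j)
           = tilde T MTheta \o id_tens T (P j) (M_op T S Psi)
       & M = range (M_op T S Psi)]) /\
  (forall (K : hrep A) (V' : psRep P K) (Psi : wandering T (V' i) -> G),
     (forall k, isometric (V' k)) -> pure T (V' i) -> inner T S Psi ->
     M_op T S Psi \o tilde T (V' j)
       = tilde T MTheta \o id_tens T (P j) (M_op T S Psi) ->
     M = range (M_op T S Psi) ->
     multi_analytic (V' i) (V' j) S MTheta (M_op T S Psi)).
Proof.
move=> G S MTheta.
have rV k : isorep (V k) := isometric_isorep (isoV k).
have iU := wold_isometry (rV i) pureV; have aU := wold_act (rV i) pureV.
have onU := wold_onto (rV i) pureV.
have rTheta k : isorep (M_Theta T (V i) (V k)) := M_Theta_isorep (rV i) pureV (rV k).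
have SE : S = M_Theta T (V i) (V i) := induced_mapE (rV i) pureV.
(* Needed twice: for the converse implication and for the final assertion. *)
have multi K (V' : psRep P K) (Psi : wandering T (V' i) -> G) :
    (forall k, isometric (V' k)) -> pure T (V' i) -> inner T S Psi ->
    M_op T S Psi \o tilde T (V' j)
      = tilde T MTheta \o id_tens T (P j) (M_op T S Psi) ->
    multi_analytic (V' i) (V' j) S MTheta (M_op T S Psi).
  move=> isoV' pureV' inPsi comm.
  have rV' k := isometric_isorep (isoV' k).
  have rS : isorep S by rewrite SE; exact: rTheta.
  exact: (M_op_multi_analytic (rV' i) pureV' (rV' j) rS (rTheta j) inPsi comm).
split=> [|K V' Psi isoV' pureV' inPsi comm _]; last exact: multi.
split=> [[_ _ Ma MS MW]|[K [V' [Psi [isoV' pureV' inPsi comm ME]]]]]; last first.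
  apply: multi_analytic_range_invariant clM M_neq0 ME _; exact: multi.
pose K := sub_hrep clM Ma.
pose iota : K -> G := fun x => val (x : subsp clM).
have iiota : isometry iota by apply: isometry_of_ip.
have aiota : intertwines iota by [].
have Miota g : M g -> range iota g.
  by move=> Mg; exists (exist _ g (mem_set Mg)).
pose J := adjop (wold T (V i)) \o iota.
have iJ : isometry J := isometry_comp (unitary_adj_isometry iU onU) iiota.
have aJ : intertwines J by move=> a k; rewrite /J /= aiota (unitary_adj_act iU aU onU).
(* Invariance is given under [S] and [MTheta], that is, for the indices [i] and [j]; these exhaust
   ['I_2]. *)
have ij k : k = i \/ k = j.
  by case: (i) (j) (k) neq_ji => [[|[]]//= ?] [[|[]]//= ?] [[|[]]//= ?] _;
    [left|right|right|left]; exact/val_inj.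
(* Conjugating by [U], V^(k) x J m = U^* iota m' = J m', where iota m' is the image of iota m in
   [M]. *)
have MV k x m : range J (V k x (J m)).
  have [m' _ m'E] : range iota (M_Theta T (V i) (V k) x (iota m)).
    apply: Miota; have Mm : M (iota m) := set_mem (valP (m : subsp clM)).
    by case: (ij k) x => -> x; [rewrite -SE; exact: MS|exact: MW].
  exists m' => //; rewrite /J /= m'E isometry_adjK//.
have [V' JV'] := psRep_restrict iJ aJ isoV MV.
have rV' k : isorep (V' k).
  by apply: (isorep_restrict iJ aJ (JV' k) (rV k)) => x; exact: cr_bounded.
have iotaV' k x m : iota (V' k x m) = M_Theta T (V i) (V k) x (iota m).
  rewrite -[LHS](unitary_adjK iU onU).
  exact: (congr1 (wold T (V i)) (JV' k x m)).
have pureV' : pure T (V' i) := pure_restrict iJ aJ (rV i) (rV' i) (JV' i) pureV.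
have Mop : M_op T S (iota \o @wval R A T (P i) K (V' i)) = iota.
  by apply: M_op_intertwiner => //; rewrite SE//; exact: iotaV'.
exists K, V', (iota \o @wval R A T (P i) K (V' i)); rewrite Mop; split=> //.
- by move=> k; exact: isorep_isometric.
- split; last by rewrite Mop.
  + exact (bounded_op_comp (isometry_bounded iiota) (isometry_bounded (wval_isometry T (V' i)))).
  + by move=> a h.
- have [iT TE] := tildeP T (rV' j); have [iT' TE'] := tildeP T (rTheta j).
  have [iI IE] := id_tensP T (P j) iiota aiota.
  apply/funext; apply: htens_ext => [||x k].
  + exact: (bounded_op_comp (isometry_bounded iiota) (isometry_bounded iT)).
  + exact: (bounded_op_comp (isometry_bounded iT') (isometry_bounded iI)).
  + by rewrite /= TE IE TE' iotaV'.
- apply/seteqP; split=> [g /Miota//|_ [m _ <-]].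
  exact: set_mem (valP (m : subsp clM)).
Qed.
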